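(* Let $k\ge 1$ and $n\ge (2k)^{2k^2}$ be integers. Then \[ f_{2k}(n,P_{2k})\le (2k-1)\,{\rm ex}(n,P_{2k})+(k-1)\binom{2k-1}{2}. \] Furthermore, equality holds when $2k-1$ is a prime and $n\in\{a(2k-1)+(k-1),\ a(2k-1)+k\}$ for some integer $a$.
   Context: $P_m$ denotes the path on $m$ vertices. For a graph $H$ and a coloring of the edges of $K_n$ with $k$ colors, an edge is NIM-$H$ if it is not contained in any monochromatic copy of $H$; $f_k(n,H)$ is the maximum, over all $k$-colorings of the edges of $K_n$, of the number of NIM-$H$ edges. ${\rm ex}(n,H)$ is the Turán number of $H$ (maximum number of edges of an $n$-vertex graph with no copy of $H$). *)

(* Defs.v *)
From mathcomp Require Import all_boot.

Set Implicit Arguments.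
Unset Strict Implicit.
Unset Printing Implicit Defensive.

(* A simple graph with vertex set V is given by its edge set G : {set {set V}},
   G \subset complete_graph V. *)
Definition complete_graph (V : finType) : {set {set V}} :=
  [set e : {set V} | #|e| == 2].

Definition path_graph (m : nat) : {set {set 'I_m}} :=
  [set [set ij.1; ij.2] | ij : 'I_m * 'I_m & ij.2 == ij.1.+1 :> nat].

Lemma path_graph_simple (m : nat) :
  path_graph m \subset complete_graph 'I_m.
Proof.
apply/subsetP => e /imsetP[[i j]]; rewrite !inE /= => /eqP eij ->.
by rewrite cards2 -(inj_eq val_inj) /= eij neq_ltn leqnn.
Qed.

(* Copies are not required to be induced. *)
Definition is_copy (W V : finType) (H : {set {set W}}) (G : {set {set V}})
    (f : {ffun W -> V}) : bool :=
  injectiveb f && [forall e in H, f @: e \in G].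

Definition copy_edges (W V : finType) (H : {set {set W}})
    (f : {ffun W -> V}) : {set {set V}} :=
  [set f @: e | e : {set W} in H].

Definition contains_copy (W V : finType) (H : {set {set W}})
    (G : {set {set V}}) : bool :=
  [exists f : {ffun W -> V}, is_copy H G f].

Definition turan_number (W : finType) (n : nat) (H : {set {set W}}) : nat :=
  \max_(G : {set {set 'I_n}} |
         (G \subset complete_graph 'I_n) && ~~ contains_copy H G) #|G|.

(* A coloring is defined on all subsets of V, but only its values on the
   2-element subsets are ever used; not all q colors have to occur. *)
Definition color_class (V : finType) (q : nat) (c : {ffun {set V} -> 'I_q})
    (i : 'I_q) : {set {set V}} :=
  [set e in complete_graph V | c e == i].

Definition NIM_edges (W V : finType) (q : nat) (H : {set {set W}})
    (c : {ffun {set V} -> 'I_q}) : {set {set V}} :=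
  [set e in complete_graph V |
    ~~ [exists i : 'I_q, exists f : {ffun W -> V},
          is_copy H (color_class c i) f && (e \in copy_edges H f)]].

Definition nim (W : finType) (q n : nat) (H : {set {set W}}) : nat :=
  \max_(c : {ffun {set 'I_n} -> 'I_q}) #|NIM_edges H c|.

(* Main.v *)
Require Import Defs.
From mathcomp Require Import all_boot all_algebra.
From mathcomp Require Import zify ring.

Set Implicit Arguments.
Unset Strict Implicit.
Unset Printing Implicit Defensive.

(* Write k = s + 1, p = 2s + 1 and Q = 2s + 2, so that P_Q has p edges.

   Upper bound.  Let V_i be the set of vertices on NIM-edges of color i.  The
   first vertex of a monochromatic P_Q of color i is never in V_i.  Given a set
   T of sp + 1 vertices, a large part of the graph is joined to T in the same
   way, each t in T by a single color; inside that part there is a P_Q of some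
   color j, and either j or a color used by at least s + 1 vertices of T (which
   then forms a large complete bipartite graph) gives a forbidden start vertex.
   Hence at most sp vertices are in every V_i.  If many vertices miss two of
   the V_i, then the bound |N_i| <= s |V_i| summed over all colors suffices;
   otherwise a single V_j has at most sp vertices, its color contributes at most
   s * sp edges and every other color at most ex(n, P_Q).

   Equality.  For the residues s and s + 1 the Faudree-Schelp theorem bounds
   ex(n, P_Q) by the size of K_s joined to n - s independent vertices.  The
   coloring places an affine plane over F_p inside K_n and colors its pairs by
   direction, the last color being the vertical direction.  The s vertical lines
   over S (a set of s nonzero abscissas) are split by the lines y = ix into p
   sets of s centers, and the centers on y = ix are joined in color i to all
   vertices outside the plane; all other pairs receive the last color, as do the
   pairs on y = ix that contain no center.

   The Faudree-Schelp bound is proved by Kopylov's method: in an edge-maximal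
   graph a component of the (s+1)-core is a clique of size p - q, and if all
   degrees exceed q then two long disjoint paths can be merged into a path on p + 1 vertices,
   so that some vertex of degree at most q can be removed. *)

(** * Paths as duplicate-free sequences *)

Definition adj (V : finType) (G : {set {set V}}) : rel V :=
  [rel u v | [set u; v] \in G].

Definition upath (V : finType) (G : {set {set V}}) (s : seq V) : bool :=
  sorted (adj G) s && uniq s.

(** By truncation this forbids the path on [m.+1] vertices; [m] counts vertices, not edges. *)
Definition pfree (V : finType) (m : nat) (G : {set {set V}}) : Prop :=
  forall s, upath G s -> size s <= m.

Section Basics.
Variable V : finType.
Implicit Types (G : {set {set V}}) (s : seq V) (u v : V).

Lemma adjC G u v : adj G u v = adj G v u.
Proof. by rewrite /adj /= setUC. Qed.

Lemma adj_neq G u v : G \subset complete_graph V -> adj G u v -> u != v.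
Proof.
move=> /subsetP sG /sG; rewrite inE cards2; by case: (u != v).
Qed.

Lemma upath_rev G s : upath G (rev s) = upath G s.
Proof.
rewrite /upath rev_uniq rev_sorted; congr (_ && _).
by apply: eq_sorted => u v; apply: adjC.
Qed.

Lemma upath_take G n s : upath G s -> upath G (take n s).
Proof. by case/andP=> so us; rewrite /upath take_sorted // take_uniq. Qed.

Lemma upath_sub G G' s : G \subset G' -> upath G s -> upath G' s.
Proof.
move=> /subsetP sGG /andP[so us]; rewrite /upath us andbT.
by apply: sub_sorted so => u v; apply: sGG.
Qed.

Lemma pfree_sub m G G' : G \subset G' -> pfree m G' -> pfree m G.
Proof. by move=> sGG fG s /(upath_sub sGG) /fG. Qed.

Lemma upath_cons G u v s :
  upath G [:: u, v & s] = [&& adj G u v, u \notin v :: s & upath G (v :: s)].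
Proof.
rewrite /upath 2!cons_uniq -/(sorted _ (v :: s)) (_ : sorted _ [:: u, v & s] =
  adj G u v && sorted (adj G) (v :: s)) //.
by case: (adj G u v) (sorted _ _) (u \notin _) => [] [] [].
Qed.

Definition seq_copy m (s : seq V) (x0 : V) : {ffun 'I_m -> V} :=
  [ffun i : 'I_m => nth x0 s i].

Lemma seq_copy_is_copy m G s x0 : upath G s -> size s = m ->
  is_copy (path_graph m) G (seq_copy m s x0).
Proof.
move=> /andP[/(sortedP x0) so us] sz; apply/andP; split.
  apply/injectiveP => i j; rewrite !ffunE => /eqP.
  by rewrite nth_uniq ?sz // => /eqP/val_inj.
apply/forall_inP => e /imsetP[[i j]]; rewrite inE /= => /eqP eij ->.
by rewrite imsetU1 imset_set1 !ffunE eij; apply: so; rewrite sz -eij.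
Qed.

Lemma copy_upath m G (f : {ffun 'I_m -> V}) :
  is_copy (path_graph m) G f -> upath G (map f (enum 'I_m)).
Proof.
case: m f => [|m] f.
  by rewrite (size0nil (size_enum_ord 0)).
move=> /andP[/injectiveP injf /forall_inP ef].
have := size_enum_ord m.+1; have := @nth_enum_ord m.+1 ord0.
have := enum_uniq 'I_m.+1; move: (enum 'I_m.+1) => en uen nthen szen.
rewrite /upath map_inj_uniq // uen andbT.
apply/(sortedP (f ord0)) => i; rewrite size_map szen => lti.
have lti' := ltnW lti; rewrite !(nth_map ord0) ?szen //.
set a := nth _ _ i; set b := nth _ _ i.+1.
have -> : adj G (f a) (f b) = (f @: [set a; b] \in G).
  by rewrite imsetU1 imset_set1.
have ea : a = i :> nat by apply: nthen.
have eb : b = i.+1 :> nat by apply: nthen.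
by apply/ef/imsetP; exists (a, b) => //; rewrite inE /= ea eb.
Qed.

Lemma pfreeP m G :
  reflect (pfree m G) (~~ contains_copy (path_graph m.+1) G).
Proof.
apply: (iffP idP) => [/existsP nc s us|fG].
  rewrite leqNgt; apply/negP => ltm; apply: nc.
  case: s us ltm => [//|x s] us ltm.
  exists (seq_copy m.+1 (take m.+1 (x :: s)) x).
  by apply: seq_copy_is_copy; [exact: upath_take | rewrite size_takel].
apply/existsP => -[f /copy_upath/fG].
by rewrite size_map size_enum_ord ltnn.
Qed.

Lemma copy_edgesP m G e :
  reflect (exists s1 u v s2, [/\ upath G (s1 ++ [:: u, v & s2]),
             size (s1 ++ [:: u, v & s2]) = m & e = [set u; v]])
    [exists f : {ffun 'I_m -> V},
       is_copy (path_graph m) G f && (e \in copy_edges (path_graph m) f)].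
Proof.
apply: (iffP existsP) => [[f /andP[cf]]|[s1 [u [v [s2 [us sz ->]]]]]].
  case/imsetP=> d /imsetP[[i j]]; rewrite inE /= => /eqP eij -> ->.
  rewrite imsetU1 imset_set1; have us := copy_upath cf.
  have szs : size (map f (enum 'I_m)) = m by rewrite size_map size_enum_ord.
  move: us szs; set s := map f _ => us szs.
  have fi l : f l = nth (f i) s l.
    by rewrite (nth_map i) ?size_enum_ord // nth_ord_enum.
  have fj : nth (f i) s i.+1 = f j.
    by rewrite -eij (nth_map i) ?size_enum_ord // nth_ord_enum.
  have lti : i.+1 < m by rewrite -eij.
  exists (take i s), (f i), (f j), (drop i.+2 s).
  suff -> : take i s ++ [:: f i, f j & drop i.+2 s] = s by [].
  rewrite -[RHS](cat_take_drop i s) (drop_nth (f i) (n := i)) ?szs 1?ltnW //.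
  by rewrite (drop_nth (f i) (n := i.+1)) ?szs // -fi fj.
exists (seq_copy m (s1 ++ [:: u, v & s2]) u); rewrite seq_copy_is_copy //=.
have lt1 : size s1 < m by rewrite -sz size_cat /=; lia.
have lt2 : (size s1).+1 < m by rewrite -sz size_cat /=; lia.
apply/imsetP; exists [set Ordinal lt1; Ordinal lt2].
  by apply/imsetP; exists (Ordinal lt1, Ordinal lt2); rewrite ?inE.
rewrite imsetU1 imset_set1 !ffunE /= !nth_cat ltnn subnn /=.
by rewrite ltnNge leqnSn /= subSnn.
Qed.

End Basics.

(** * Cycles from crossing chords *)

Lemma count_nth (T : Type) (x0 : T) (a : pred T) (w : seq T) :
  count a w = \sum_(0 <= i < size w) a (nth x0 w i).
Proof. by rewrite -sum1_count big_mkcond (big_nth x0). Qed.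

Lemma sum_window (a b c : nat) :
  \sum_(0 <= l < a + b + c) ~~ (a <= l < a + b) <= a + c.
Proof.
rewrite (big_cat_nat (n := a + b)) ?leq_addr //=.
rewrite (big_cat_nat (n := a)) ?leq_addr //= -addnA leq_add //.
  by apply: leq_trans (leq_sum _ (fun i _ => leq_b1 _)) _;
    rewrite sum_nat_const_nat subn0 muln1.
rewrite big_nat_cond big1 ?add0n => [|l /andP[-> _]] //.
by apply: leq_trans (leq_sum _ (fun i _ => leq_b1 _)) _;
   rewrite sum_nat_const_nat muln1 addKn.
Qed.

(** An end of a path is not adjacent to itself. Dropping index 0 for one end, and the last index for
    the other in the next lemma, lets one index [l] stand for chords to the positions [l.+1] and
    [l]. *)
Lemma sum_shift (m : nat) (b : nat -> nat) : 0 < m -> b 0 = 0 ->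
  \sum_(0 <= i < m) b i = \sum_(0 <= i < m.-1) b i.+1.
Proof. by case: m => // m _ b0; rewrite big_nat_recl // b0. Qed.

Lemma sum_last (m : nat) (b : nat -> nat) : 0 < m -> b m.-1 = 0 ->
  \sum_(0 <= i < m) b i = \sum_(0 <= i < m.-1) b i.
Proof. by case: m => // m _ /= b0; rewrite big_nat_recr //= b0 addn0. Qed.

Section Posa.
Variables (T : eqType) (e : rel T).
Hypotheses (esym : symmetric e) (eirr : irreflexive e).

(* Take a crossing with [j - i] minimal: the cycle only skips the vertices
   strictly between [i] and [j], none of which is adjacent to an end. *)
Lemma crossing_cycle (x0 : T) (w : seq T) (i j : nat) :
  uniq w -> sorted e w -> i < j < size w ->
  e (last x0 w) (nth x0 w i) -> e (head x0 w) (nth x0 w j) ->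
  exists c, [/\ uniq c, cycle e c, {subset c <= w} &
    minn (size w) (count (e (head x0 w)) w + count (e (last x0 w)) w)
      <= size c].
Proof.
move=> uw sw; set x := head x0 w; set y := last x0 w.
have [d] := ubnP (j - i); elim: d i j => [|d IHd] i j // led /andP[ltij ltj].
move=> eyi exj; set m := size w in ltj *.
pose P d' := [exists ij : 'I_m * 'I_m,
  [&& ij.1 < ij.2, ij.2 - ij.1 < d', e y (nth x0 w ij.1)
    & e x (nth x0 w ij.2)]].
have [/existsP[[i' j'] /and4P[/= lt' le' eyi' exj']]|nP] := boolP (P d).
  by apply: (IHd i' j' le') => //; rewrite lt' ltn_ord.
have lti : i < m by lia.
have nocross i' j' : i' < j' -> j' < m -> j' - i' < d ->
    e y (nth x0 w i') -> e x (nth x0 w j') -> False.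
  move=> lt' ltm' led' eyi' exj'; have ltim' := ltn_trans lt' ltm'.
  case/existsP: nP; exists (Ordinal ltim', Ordinal ltm').
  by rewrite /= lt' led' eyi' exj'.
(* From the head along [w] to position [i], over a chord to the last vertex, back to position [j],
   and over the other chord to the head. *)
exists (take i.+1 w ++ rev (drop j w)).
have szc : size (take i.+1 w ++ rev (drop j w)) = m - (j - i.+1).
  by rewrite size_cat size_rev size_drop size_takel -/m; lia.
have xE : x = nth x0 w 0 by rewrite nth0.
have yE : y = nth x0 w m.-1 by rewrite nth_last.
have m_gt0 : 0 < m by lia.
have wE : w = x :: behead w by move: m_gt0; rewrite /m /x; case: (w).
split.
- have := uw; rewrite -{1}(cat_take_drop j w) !cat_uniq rev_uniq.
  case/and3P=> utk nh ->; rewrite andbT take_uniq //=.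
  apply: contra nh => /hasP[z]; rewrite mem_rev => zd zt.
  apply/hasP; exists z => //.
  by move: zt; rewrite -(take_takel w ltij) => /mem_take.
- have -> : take i.+1 w = x :: take i (behead w).
    by rewrite {1}wE.
  rewrite /= rcons_cat cat_path.
  have -> : path e x (take i (behead w)).
    by have := take_sorted i.+1 sw; rewrite {1}wE.
  have -> : last x (take i (behead w)) = nth x0 w i.
    rewrite -[LHS](last_cons x0 x) -/(take i.+1 (x :: behead w)) -wE.
    by rewrite -nth_last size_takel //= nth_take.
  have [z [s' ds]] : exists z s', drop j w = rcons s' z.
    by case/lastP: (drop j w) (size_drop j w) => [/=|s' z _]; [lia|exists z, s'].
  have zy : z = y by rewrite /y -(cat_take_drop j w) ds last_cat last_rcons.
  rewrite ds rev_rcons zy /= esym eyi.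
  have := drop_sorted j sw; rewrite ds zy -rev_sorted rev_rcons /=.
  rewrite rcons_path (@eq_path _ _ e) => [-> /=|u v]; last exact: esym.
  suff -> : last y (rev s') = nth x0 w j by rewrite esym.
  have := congr1 (nth x0 ^~ 0) ds; rewrite nth_drop addn0 => ->.
  rewrite zy; case: s' {ds} => //= a s'; by rewrite rev_cons last_rcons.
- move=> z; rewrite mem_cat mem_rev => /orP[/mem_take|/mem_drop] //.
rewrite szc !(count_nth x0) -/m.
rewrite (sum_shift (b := fun l => e x (nth x0 w l))) -?xE ?eirr //.
rewrite (sum_last (b := fun l => e y (nth x0 w l))) -?yE ?eirr //.
have [->|neqj] := eqVneq j i.+1; first by rewrite subnn subn0 geq_minl.
apply: leq_trans (geq_minr _ _) _; rewrite -big_split /=.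
(* Index [l] stands for the chords from [y] to position [l] and from [x] to position [l.+1]. Both at
   once would cross with gap 1, and for [i < l < j.-1] either one would give a crossing narrower
   than that of [i] and [j]. *)
apply: (@leq_trans (\sum_(0 <= l < m.-1) ~~ (i < l < j.-1))).
  rewrite big_nat_cond [leqRHS]big_nat_cond; apply: leq_sum => l.
  rewrite andbT => /andP[_ ltl].
  case exl: (e x _); case eyl: (e y _) => //=.
  - by case: (nocross l l.+1); rewrite ?subSnn //; lia.
  - case: andP => // -[lt1 lt2].
    by case: (nocross i l.+1) => //; lia.
  - case: andP => // -[lt1 lt2].
    by case: (nocross l j) => //; lia.
have -> : m.-1 = i.+1 + (j - i.+2) + (m - j) by lia.
have -> : j.-1 = i.+1 + (j - i.+2) by lia.
apply: leq_trans (sum_window _ _ _) _; lia.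
Qed.
End Posa.

(** * Long paths from degree conditions *)

Section Paths.
Variables (V : finType) (G : {set {set V}}).
Hypothesis sG : G \subset complete_graph V.
Implicit Types (S T X Y : {set V}) (u v : V) (s w : seq V).

Definition nbrs S u : {set V} := [set v in S | adj G u v].

(** Connectivity in terms of cuts, since the arguments need an edge that leaves a given cycle or
    set. *)
Definition cut_connected S : Prop := forall T, T \subset S -> T != set0 ->
  T != S -> exists u v, [/\ u \in T, v \in S, v \notin T & adj G u v].

Lemma adj_irr : irreflexive (adj G).
Proof. by move=> u; apply/negP => /(adj_neq sG); rewrite eqxx. Qed.

Lemma upath_cat s1 s2 u v : upath G (rcons s1 u) -> upath G (v :: s2) ->
  uniq (rcons s1 u ++ v :: s2) -> adj G u v -> upath G (rcons s1 u ++ v :: s2).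
Proof.
case/andP=> so1 _ /andP[so2 _] us uv; rewrite /upath us andbT.
case: s1 so1 {us} => [|a s1] /= so1; first by apply/andP.
by rewrite cat_path so1 last_rcons /=; apply/andP.
Qed.

Lemma card_nbrs_count S u w : {subset nbrs S u <= w} ->
  #|nbrs S u| <= count (adj G u) w.
Proof.
move=> sub; rewrite cardE -size_filter uniq_leq_size ?enum_uniq // => v.
by rewrite mem_enum mem_filter => vN; rewrite sub // andbT; case/setIdP: vN.
Qed.

(** Dirac's argument: an end with a neighbor in [S] off the path extends it. Otherwise the degree
    sum of the ends forces two crossing chords to consecutive positions, hence a cycle on the same
    vertices; it is opened where an edge leaves it. *)
Lemma dirac_path S m : cut_connected S -> 0 < m <= #|S| ->
  {in S, forall v, m <= #|nbrs S v|.*2} ->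
  exists w, [/\ upath G w, size w = m & {subset w <= S}].
Proof.
move=> conS /andP[]; case: m => // m _ leS degS.
elim: m leS degS => [|m IHm] leS degS.
  have /card_gt0P[x xS] := leS.
  by exists [:: x]; split=> // v; rewrite inE => /eqP->.
have [|v vS|w [uw szw wS]] := IHm; [exact: ltnW|exact/ltnW/degS|].
have step x w' : upath G (x :: w') -> size (x :: w') = m.+1 ->
    {subset x :: w' <= S} -> ~~ [forall v in nbrs S x, v \in x :: w'] ->
    exists w'', [/\ upath G w'', size w'' = m.+2 & {subset w'' <= S}].
  move=> ux szx xS /forall_inPn[v /setIdP[vS xv] vn].
  exists [:: v, x & w']; split; [|by rewrite -szx|].
    by rewrite upath_cons vn ux adjC xv.
  by move=> z; rewrite inE => /orP[/eqP->|/xS].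
have [x [w' wE]] : exists x w', w = x :: w'.
  by case: (w) szw => // x w'; exists x, w'.
have [y [w'' wE']] : exists y w'', w = rcons w'' y.
  by case/lastP: (w) szw => // w'' y; exists y, w''.
have [nx|nx] := boolP [forall v in nbrs S x, v \in x :: w']; last first.
  by apply: step nx; rewrite -wE.
have [ny|ny] := boolP [forall v in nbrs S y, v \in y :: rev w'']; last first.
  apply: step ny; rewrite -rev_rcons -wE' ?upath_rev ?size_rev // => v.
  by rewrite mem_rev; apply: wS.
have cx : #|nbrs S x| <= count (adj G x) w.
  by apply: card_nbrs_count => v; rewrite wE; apply: (forall_inP nx).
have cy : #|nbrs S y| <= count (adj G y) w.
  apply: card_nbrs_count => v /(forall_inP ny).
  by rewrite -rev_rcons mem_rev wE'.
have xS : x \in S by apply: wS; rewrite wE mem_head.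
have yS : y \in S by apply: wS; rewrite wE' mem_rcons mem_head.
have dx := degS _ xS; have dy := degS _ yS.
case/andP: (uw) => sow unw.
have hx : head x w = x by rewrite wE.
have hy : last x w = y by rewrite wE' last_rcons.
have [c [unc cyc subc szc]] : exists c, [/\ uniq c, cycle (adj G) c,
    {subset c <= w} & size w <= size c].
  have [/hasP[i]|ncross] := boolP (has (fun i => adj G y (nth x w i) &&
      adj G x (nth x w i.+1)) (iota 0 m)).
    rewrite mem_iota /= => ltim /andP[yi xi].
    have [|||||c [? ? ? szc]] := @crossing_cycle _ (adj G) (adjC G) adj_irr x w i i.+1 => //.
    - by rewrite ltnSn szw ltnS.
    - by rewrite hy.
    - by rewrite hx.
    exists c; split=> //; move: szc; rewrite hx hy; apply: leq_trans.
    rewrite leq_min leqnn /=; apply: leq_trans (leq_add cx cy).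
    rewrite szw; move: dx dy; clear; move: #|nbrs S x| #|nbrs S y| => a b; lia.
  (* Without such chords each of the [m] gaps of [w] counts at most one chord, against a degree sum
     of at least [m.+2]. *)
  exfalso; move: cx cy; rewrite !(count_nth x) szw.
  rewrite (sum_shift (b := fun l => adj G x (nth x w l))) //; last first.
    by rewrite nth0 hx adj_irr.
  rewrite (sum_last (b := fun l => adj G y (nth x w l))) //; last first.
    by have := nth_last x w; rewrite szw hy /= => ->; rewrite adj_irr.
  move=> cx cy; have := leq_add cx cy; rewrite -big_split /= leqNgt => /negP[].
  apply: (@leq_ltn_trans (\sum_(0 <= i < m) 1)); last first.
    rewrite sum_nat_const_nat subn0 muln1; move: dx dy; clear.
    by move: #|nbrs S x| #|nbrs S y| => a b; lia.
  rewrite big_nat_cond [leqRHS]big_nat_cond; apply: leq_sum => i /andP[/andP[_ lti] _].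
  have := hasPn ncross i; rewrite mem_iota /= => /(_ lti).
  by case: (adj G y _); case: (adj G x _).
have eqc : c =i w by apply: (uniq_min_size unc subc szc).2.
have [u [v [uT vS vT uv]]] : exists u v,
    [/\ u \in [set z in w], v \in S, v \notin [set z in w] & adj G u v].
  apply: conS; first by apply/subsetP => z; rewrite inE; apply: wS.
    by apply/set0Pn; exists x; rewrite inE wE mem_head.
  apply: contraTneq leS => <-; rewrite -ltnNge (leq_ltn_trans _ (_ : m.+1 < m.+2)) //.
  by rewrite cardsE -szw card_size.
rewrite !inE -!eqc in uT vT.
have [i c' rc] := rot_to uT.
have szc' : size (u :: c') = m.+1.
  by rewrite -rc size_rot -szw; apply/perm_size/uniq_perm.
exists [:: v, u & c']; split; first 1 last.
- by rewrite /= -szc'.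
- move=> z; rewrite inE => /orP[/eqP-> //|]; rewrite -rc mem_rot eqc; exact: wS.
rewrite upath_cons adjC uv -rc mem_rot vT /= /upath rot_uniq unc andbT.
by have := cyc; rewrite -(rot_cycle i) rc /= rcons_path => /andP[].
Qed.

(* [None] is a universal vertex: a cycle on m + 1 vertices of the cone yields
   a path on m vertices of [G]. *)
Definition cone : rel (option V) := fun a b =>
  match a, b with
  | Some u, Some v => adj G u v
  | None, None => false
  | _, _ => true
  end.

Lemma cone_cycle c : uniq c -> cycle cone c ->
  exists s, upath G s /\ size c <= (size s).+1.
Proof.
move=> uc cyc.
suff [c' [uc' sc' nc' lec']] : exists c',
    [/\ uniq c', sorted cone c', None \notin c' & size c <= (size c').+1].
  exists (pmap id c'); have cE : map Some (pmap id c') = c'.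
    elim: c' nc' {uc' sc' lec'} => //= -[a|] c' IHc; rewrite inE //= => nc.
    by rewrite IHc.
  split; last by rewrite -(size_map Some (pmap id c')) cE.
  rewrite -cE map_inj_uniq in uc'; last by move=> ? ? [].
  by rewrite /upath uc' andbT; move: sc'; rewrite -{1}cE sorted_map; apply: sub_sorted.
have [/rot_to[i c' rc]|nc] := boolP (None \in c).
  exists c'; have := uc; rewrite -(rot_uniq i) rc /= => /andP[nc' ->].
  have := cyc; rewrite -(rot_cycle i) rc /= rcons_path => /andP[/path_sorted-> _].
  by rewrite nc' -(size_rot i) rc.
case: c uc cyc nc => [|a c] /=; first by exists [::].
move=> /andP[_ uc]; rewrite rcons_path inE negb_or => /andP[/path_sorted sc _].
by case/andP=> _ nc; exists c.
Qed.

(** In the cone the two paths become one path from [v] through [None] to [u]. Both ends are adjacent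
    to [None], so one edge from an end to the opposite path already gives crossing chords. *)
Lemma join_paths A B u v : upath G (rcons A u) -> upath G (v :: B) ->
  uniq (rcons A u ++ v :: B) ->
  has (adj G u) (v :: B) || has (adj G v) (rcons A u) ->
  exists s, upath G s /\
    minn (size (rcons A u ++ v :: B))
     (count (adj G u) (rcons A u ++ v :: B)
        + count (adj G v) (rcons A u ++ v :: B)).+1 <= size s.
Proof.
set A' := rcons A u; set B' := v :: B => uA uB uAB cross.
set w := map Some B' ++ None :: map Some A'.
have sc : symmetric cone by move=> [a|] [b|] //; apply: adjC.
have ic : irreflexive cone by move=> [a|] //; apply: adj_irr.
have szw : size w = (size (A' ++ B')).+1.
  by rewrite /w !size_cat /= !size_map addnS addnC.
have uw : uniq w.
  have injS : injective (@Some V) by move=> ? ? [].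
  rewrite /w uniq_catC cat_cons cons_uniq -map_cat map_inj_uniq // uAB andbT.
  by apply/mapP => -[].
have sow : sorted cone w.
  case/andP: uA; rewrite -/A' => sA _; case/andP: uB => sB _.
  rewrite /w [map Some B']/= cat_cons /= cat_path path_map.
  rewrite [path _ v B]sB /=.
  have -> : path cone None (map Some A') = sorted cone (map Some A').
    by rewrite /A'; case: (A).
  by rewrite sorted_map last_map.
have hw : head None w = Some v by [].
have lw : last None w = Some u.
  by rewrite /w last_cat /= /A' map_rcons last_rcons.
have [i [j [ltij eui evj]]] : exists i j, [/\ i < j < size w,
    cone (Some u) (nth None w i) & cone (Some v) (nth None w j)].
  have szE : size w = (size B' + size A').+1.
    by rewrite szw size_cat addnC.
  have nN : nth None w (size B') = None.
    by rewrite nth_cat size_map ltnn subnn.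
  case/orP: cross => /hasP[z zB adjz].
    exists (index z B'), (size B').
    rewrite nN index_mem zB szE ltnS leq_addr; split=> //.
    by rewrite nth_cat size_map index_mem zB (nth_map u) ?index_mem // nth_index.
  exists (size B'), (size B' + (index z A').+1).
  rewrite nN szE addnS !ltnS leq_addr ltn_add2l index_mem zB; split=> //.
  rewrite nth_cat size_map ltnNge ltnW ?ltnS ?leq_addr //= -addnS addKn /=.
  by rewrite (nth_map u) ?index_mem // nth_index.
rewrite -lw in eui; rewrite -hw in evj.
have [c [uc cyc _]] := crossing_cycle sc ic uw sow ltij eui evj.
rewrite hw lw => szc; have [s [us szs]] := cone_cycle uc cyc.
exists s; split=> //; rewrite -ltnS -[(minn _ _).+1]minnSS -szw.
apply: leq_trans szs; apply: leq_trans szc.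
have cw z : count (cone (Some z)) w = (count (adj G z) (A' ++ B')).+1.
  by rewrite /w !count_cat /= !count_map addnS addnC.
by rewrite !cw addSn addnS [in leqRHS]addnC.
Qed.

(* The pair [(u, v)] and the two paths are chosen with [A] and [B] as long as
   possible, so that all relevant neighbors of [u] and [v] lie on them. *)
Lemma kopylov X Y d1 d2 p : pfree p G -> p <= d1 + d2 ->
  {in X, forall u, d1 <= #|nbrs X u|} -> {in Y, forall v, d2 <= #|nbrs Y v|} ->
  (exists u v A B, [/\ u \in X, v \in Y, ~~ adj G u v &
    [/\ upath G (rcons A u), upath G (v :: B), uniq (rcons A u ++ v :: B)
     & p < size (rcons A u ++ v :: B)]]) ->
  exists u v A B, [/\ u \in X, v \in Y, uniq (rcons A u ++ v :: B)
    & [/\ upath G (v :: B), {subset nbrs X u <= A} & {subset nbrs Y v <= B}]].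
Proof.
move=> fG led degX degY [u [v [A [B [uX vY nuv [uA uB uAB ltp]]]]]].
have [d led'] := ubnP (#|V| - size (rcons A u ++ v :: B)).
elim: d u v A B uX vY nuv uA uB uAB ltp led' => // d IHd u v A B uX vY nuv uA uB uAB ltp led'.
set P := rcons A u ++ v :: B in uAB ltp led' *.
have longer (P' : seq V) : uniq P' -> size P' = (size P).+1 -> #|V| - size P' < d.
  move=> uP' szP'; have := max_card (mem P').
  rewrite (card_uniqP uP') szP'; move: led'; clear.
  by move: #|V| (size P) => a b; lia.
have [/forall_inP nX|/forall_inPn[y /setIdP[yX uy] yP]] :=
  boolP [forall y in nbrs X u, y \in P]; last first.
  have uP' : uniq (rcons (rcons A u) y ++ v :: B).
    rewrite cat_rcons (perm_uniq (s2 := y :: P)) ?cons_uniq ?yP //.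
    by rewrite -[y :: _ :: _]cat1s perm_catCA.
  have szP' : size (rcons (rcons A u) y ++ v :: B) = (size P).+1.
    by rewrite /P !size_cat !size_rcons addSn.
  have uA' : upath G (rcons (rcons A u) y).
    by rewrite -cats1; apply: upath_cat uA _ _ uy; rewrite // cats1;
       move: uP'; rewrite cat_uniq => /and3P[].
  have [yv|nyv] := boolP (adj G y v); last first.
    by apply: (IHd y v (rcons A u) B) => //; [rewrite szP' ltnS ltnW|apply: longer].
  by have := fG _ (upath_cat uA' uB uP' yv); rewrite szP' leqNgt ltnW.
have [/forall_inP nY|/forall_inPn[y /setIdP[yY vy] yP]] :=
  boolP [forall y in nbrs Y v, y \in P]; last first.
  have uP' : uniq (rcons A u ++ [:: y, v & B]).
    rewrite (perm_uniq (s2 := y :: P)) ?cons_uniq ?yP //.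
    by rewrite -[y :: _ :: _]cat1s perm_catCA.
  have szP' : size (rcons A u ++ [:: y, v & B]) = (size P).+1.
    by rewrite /P !size_cat /= !addnS.
  have uB' : upath G [:: y, v & B].
    rewrite upath_cons adjC vy uB andbT; apply: contra yP.
    by rewrite mem_cat orbC => ->.
  have [uy|nuy] := boolP (adj G u y); last first.
    by apply: (IHd u y A (v :: B)) => //; [rewrite szP' ltnS ltnW|apply: longer].
  by have := fG _ (upath_cat uA uB' uP' uy); rewrite szP' leqNgt ltnW.
(* A cross edge would allow merging into a path on at least [minn (size P) (d1 + d2).+1] vertices,
   which is more than [p]. *)
have [cross|] := boolP (has (adj G u) (v :: B) || has (adj G v) (rcons A u)).
  have [s [us]] := join_paths uA uB uAB cross.
  have := card_nbrs_count nX; have := card_nbrs_count nY.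
  have := degX _ uX; have := degY _ vY; have := fG _ us.
  rewrite -/P; move: led ltp; clear.
  move: (minn _ _) (minnE (size P) (count (adj G u) P + count (adj G v) P).+1).
  move: (size P) (size s) (count _ P) (count _ P) #|_| #|_| => *; lia.
rewrite negb_or => /andP[/hasPn nB /hasPn nA].
exists u, v, A, B; split=> //; split=> // z zN.
  have := nX z zN; case/setIdP: zN => _ uz.
  rewrite mem_cat mem_rcons inE => /orP[/orP[/eqP zu|//]|/nB]; last by rewrite uz.
  by rewrite zu adj_irr in uz.
have := nY z zN; case/setIdP: zN => _ vz.
rewrite mem_cat => /orP[/nA|]; first by rewrite vz.
by rewrite inE => /orP[/eqP zv|//]; rewrite zv adj_irr in vz.
Qed.

End Paths.

(** * Linking a clique to a disjoint cycle *)

Section CliquesAndCycles.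
Variables (V : finType) (G : {set {set V}}).
Hypothesis sG : G \subset complete_graph V.
Implicit Types (S T X Y C : {set V}) (u v : V) (s w B : seq V).

Definition clique C : Prop := {in C &, forall u v, u != v -> adj G u v}.

Lemma clique_upath C s : clique C -> {subset s <= C} -> uniq s -> upath G s.
Proof.
move=> clC sC us; rewrite /upath us andbT.
elim: s sC us => // a [//|b s] IHs sC /= /andP[abs us].
apply/andP; split; last by apply: IHs => // z zs; apply: sC; rewrite inE zs orbT.
apply: clC; rewrite ?sC ?inE ?eqxx ?orbT //.
by apply: contraNneq abs => ->; rewrite inE eqxx.
Qed.

(** Cut [B] after the last vertex adjacent to [v]: the edge back to [v] closes a cycle through all
    the neighbors in question. *)
Lemma last_nbr_cycle S v B : upath G (v :: B) -> {subset nbrs G S v <= B} ->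
  0 < #|nbrs G S v| ->
  exists K, [/\ uniq K, cycle (adj G) K, {subset K <= v :: B}, v \in K &
    #|nbrs G S v| < size K].
Proof.
elim/last_ind: B => [_ sub /card_gt0P[z /sub] //|B b IHB] uB sub gt0.
have [vb|nvb] := boolP (adj G v b); last first.
  have [| |//|K [uK cK sK vK szK]] := IHB.
  - have := upath_take (size B).+1 uB.
    by rewrite -rcons_cons -cats1 take_size_cat.
  - move=> z zN; have := sub z zN; rewrite mem_rcons inE => /orP[/eqP zb|//].
    by case/setIdP: zN; rewrite zb (negPf nvb).
  exists K; split=> // z /sK; rewrite !inE mem_rcons inE.
  by case/orP=> ->; rewrite ?orbT.
exists (v :: rcons B b); case/andP: uB => soB uB.
split; rewrite ?mem_head //.
  by rewrite /cycle rcons_path last_rcons [path _ _ _]soB adjC.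
apply: leq_ltn_trans (_ : size (rcons B b) < _) => //.
by rewrite cardE uniq_leq_size ?enum_uniq // => z; rewrite mem_enum => /sub.
Qed.

(** Run through the clique, leave it along a path that meets [K] only at its end, and go once around
    the cycle. *)
Lemma clique_cycle_path S C K : cut_connected G S -> C \subset S -> clique C ->
  C != set0 -> uniq K -> cycle (adj G) K -> ~~ has (mem C) K ->
  has (mem S) K ->
  exists s, upath G s /\ #|C| + size K <= size s.
Proof.
move=> conS sCS clC /set0Pn[x0 x0C] uK cyK /hasPn dCK /hasP[v vK vS].
pose r : rel V := [rel a b | adj G a b && ((b \notin C) && (b \notin K))].
pose T := [set z in S | [exists x in C, connect r x z]].
have sCT : C \subset T.
  apply/subsetP => z zC; rewrite inE (subsetP sCS) //=.
  by apply/exists_inP; exists z.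
have rP x p : path r x p -> path (adj G) x p /\
    {in p, forall z, (z \notin C) && (z \notin K)}.
  elim: p x => //= y p IHp x /andP[/andP[xy yn] /IHp[-> pn]].
  by split=> [|z]; [rewrite andbT|rewrite inE => /orP[/eqP->|/pn]].
have vT : v \notin T.
  apply/negP => /setIdP[_ /exists_inP[x xC /connectP[p xp vE]]].
  have [_ pn] := rP _ _ xp; case: p vE xp pn => [/= vx|a p vE _ pn].
    by have := dCK v vK; rewrite vx /= xC.
  have va : v \in a :: p by rewrite vE /= mem_last.
  by have := pn v va; rewrite vK andbF.
have [a [b [aT bS bT ab]]] : exists a b,
    [/\ a \in T, b \in S, b \notin T & adj G a b].
  apply: conS; first by apply/subsetP => z /setIdP[].
    by apply/set0Pn; exists x0; apply: (subsetP sCT).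
  by apply: contraNneq vT => ->.
have bC : b \notin C by apply: contra bT; apply: (subsetP sCT).
case/setIdP: aT => _ /exists_inP[x xC xa].
(* Otherwise the edge from [a] to [b] would prolong the walk and put [b] into [T]. *)
have bK : b \in K.
  apply: contraR bT => bK; rewrite inE bS; apply/exists_inP; exists x => //.
  by apply: connect_trans xa (connect1 _); apply/and3P.
case/connectP: xa => p0 xp0 aE; move: aE; case/shortenP: xp0 => p xp up _ aE.
have [xpG pn] := rP _ _ xp.
have [i K' rK] := rot_to bK.
have uK' : upath G (b :: K').
  rewrite -rK /upath rot_uniq uK andbT.
  by have := cyK; rewrite -(rot_cycle i) rK /= rcons_path => /andP[].
have memK z : (z \in b :: K') = (z \in K) by rewrite -rK mem_rot.
have uCx : upath G (rcons (enum (C :\ x)) x).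
  apply: (clique_upath clC) => [z|].
    by rewrite mem_rcons inE mem_enum => /orP[/eqP->//|/setD1P[]].
  by rewrite rcons_uniq mem_enum !inE eqxx enum_uniq.
have us : uniq (enum (C :\ x) ++ (x :: p) ++ b :: K').
  have pC z : z \in p -> z \notin C by case/pn/andP.
  have pK z : z \in p -> z \notin K by case/pn/andP.
  have CK z : z \in C -> z \notin K by apply: contraL => /dCK.
  rewrite cat_uniq enum_uniq cat_uniq up; case/andP: uK' => _ ->; rewrite andbT.
  apply/and3P; split=> //.
    apply/hasPn => z; rewrite mem_cat memK inE mem_enum !inE.
    case/orP=> [/orP[/eqP->|/pC/negPf->]|zK]; rewrite ?eqxx ?andbF //.
    by rewrite negb_and orbC (contraTN (CK z)).
  apply/hasPn => z; rewrite memK /= inE => zK.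
  rewrite negb_or (contraTneq _ zK) => [|->]; last exact: CK.
  by rewrite (contraTN (pK z)).
exists (enum (C :\ x) ++ (x :: p) ++ b :: K'); split.
  rewrite /upath us andbT cat_cons -(cat_rcons x).
  have pxb : path (adj G) x (p ++ b :: K').
    by rewrite cat_path xpG -aE /=; case/andP: uK' => so _; apply/andP.
  case/andP: uCx => so _; case: (enum _) so => [|c E] //= so.
  by rewrite cat_path so last_rcons.
have szK : size (b :: K') = size K by rewrite -rK size_rot.
rewrite !size_cat -cardE szK (cardsD1 x C) xC /=.
by rewrite [1 + _]addnC !addnA leq_add2r leq_add2l.
Qed.

End CliquesAndCycles.

(** * The Faudree-Schelp theorem *)

Lemma bin2_double n : 'C(n, 2) * 2 = n * n.-1.
Proof. by elim: n => // n IHn; rewrite binS bin1 mulnDl IHn; case: n {IHn} => //= n; lia. Qed.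

(* The extremal value is attained by [n %/ p] disjoint copies of [K_p] and one
   [K_(n %% p)], where [p = 2 s + 1]. *)
Definition fs (s n : nat) : nat :=
  n %/ s.*2.+1 * 'C(s.*2.+1, 2) + 'C(n %% s.*2.+1, 2).

Section FsArith.
Variable s : nat.
Notation p := s.*2.+1.

(** The term [r * (p - r)] with [r = n %% p] is the defect of [fs] against [s * n]; the next
    estimates compare defects. *)
Lemma fs_double n : 2 * fs s n + n %% p * (p - n %% p) = 2 * (s * n).
Proof.
rewrite /fs; have := bin2_double p; have := bin2_double (n %% p).
have := ltn_pmod n (isT : 0 < p); have := divn_eq n p.
move: (n %/ p) (n %% p) => a r -> ltr; case: r ltr => [|r] /= ltr Er Ep; nia.
Qed.

Lemma fs_le n : fs s n <= s * n.
Proof. by rewrite -(leq_pmul2l (isT : 0 < 2)) -fs_double leq_addr. Qed.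

(** The defect is largest at the residues [s] and [s.+1]. *)
Lemma fs_ge n : 2 * (s * n) <= 2 * fs s n + s * s.+1.
Proof.
have := fs_double n; have := ltn_pmod n (isT : 0 < p).
move: (n %% p) => r ltr E; have : r * (p - r) <= s * s.+1; last lia.
have [ler|ltsr] := leqP r s; nia.
Qed.

Lemma fsS n : fs s n.+1 = fs s n + n %% p.
Proof.
have := fs_double n; have := fs_double n.+1.
have ltr := ltn_pmod n (isT : 0 < p).
have -> : n.+1 %% p = if (n %% p).+1 == p then 0 else (n %% p).+1.
  rewrite -addn1 -modnDml addn1.
  by case: eqP => [->|neq]; rewrite ?modnn // modn_small //; lia.
by case: eqP; nia.
Qed.

(** The defect is subadditive in the residues. If these add up to at least [p], its symmetry under
    [x -> p - x] reduces to the case without carry. *)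
Lemma fs_superadd a b : fs s a + fs s b <= fs s (a + b).
Proof.
have aux x y : x + y <= p -> (x + y) * (p - (x + y)) <= x * (p - x) + y * (p - y).
  move=> le; have -> : p - x = y + (p - (x + y)) by lia.
  have -> : p - y = x + (p - (x + y)) by lia.
  by rewrite !mulnDr mulnDl; lia.
have lta := ltn_pmod a (isT : 0 < p); have ltb := ltn_pmod b (isT : 0 < p).
suff : (a + b) %% p * (p - (a + b) %% p) <=
       a %% p * (p - a %% p) + b %% p * (p - b %% p).
  have := fs_double a; have := fs_double b; have := fs_double (a + b).
  move: (_ * (p - _)) (_ * (p - _)) (_ * (p - _)) => x y z.
  by rewrite mulnDr; lia.
rewrite modnD //; case: leqP => /= cmp; rewrite ?mul1n ?mul0n ?subn0.
  by apply: aux; lia.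
move: (a %% p) (b %% p) lta ltb cmp => x y ltx lty cmp.
have := aux (p - x) (p - y); rewrite !subKn; [|lia|lia].
have -> : p - (p - x + (p - y)) = x + y - p by lia.
have -> : p - (x + y - p) = p - x + (p - y) by lia.
rewrite mulnC [(p - x) * x]mulnC [(p - y) * y]mulnC; apply; lia.
Qed.

Lemma bin_le_fs n : n <= p -> 'C(n, 2) <= fs s n.
Proof.
rewrite leq_eqVlt => /orP[/eqP->|ltn]; rewrite /fs; last first.
  by rewrite modn_small // leq_addl.
by rewrite divnn modnn mul1n leq_addr.
Qed.

End FsArith.

(** * Edge counts under vertex deletion, cores and components *)

Section EdgeCount.
Variables (V : finType) (G : {set {set V}}).
Hypothesis sG : G \subset complete_graph V.
Implicit Types (A C T : {set V}) (u v : V).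

Definition edges_in A : {set {set V}} := [set e in G | e \subset A].

Lemma edge_pair e : e \in G -> exists u v, e = [set u; v].
Proof.
by move=> /(subsetP sG); rewrite inE => /cards2P[u [v [_ ->]]]; exists u, v.
Qed.

Lemma edges_in_le_bin A : #|edges_in A| <= 'C(#|A|, 2).
Proof.
rewrite -cards_draws subset_leq_card //; apply/subsetP => e.
by rewrite !inE => /andP[/(subsetP sG)]; rewrite inE => -> ->.
Qed.

Lemma edges_in_del A v : v \in A ->
  #|edges_in A| = #|nbrs G A v| + #|edges_in (A :\ v)|.
Proof.
move=> vA; rewrite -(cardsID [set e : {set V} | v \in e] (edges_in A)); congr (_ + _).
  have inj : {in nbrs G A v &, injective (fun u => [set v; u])}.
    move=> a b; rewrite !inE => /andP[_ va] /andP[_ vb] /setP/(_ a).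
    rewrite !inE eqxx orbT; have := adj_neq sG va; rewrite eq_sym => /negPf->.
    by move/esym/eqP.
  rewrite -(card_in_imset inj); apply: eq_card => e; rewrite !inE.
  apply/andP/imsetP => [[/andP[eG eA] ve]|[u /setIdP[uA vu] ->]].
    have [a [b eE]] := edge_pair eG; subst e.
    move: eA; rewrite subUset !sub1set => /andP[aA bA].
    move: ve; rewrite !inE => /orP[/eqP vE|/eqP vE]; subst v.
      by exists b; rewrite // inE bA.
    by exists a; [rewrite inE aA adjC|rewrite setUC].
  by rewrite [_ \in G]vu subUset !sub1set vA uA !inE eqxx.
apply: eq_card => e; rewrite !inE subsetD1.
by case: (_ \in G); case: (_ \subset _); case: (v \in e).
Qed.

Lemma edges_in_closed A T : T \subset A ->
  {in T & A :\: T, forall u v, ~~ adj G u v} ->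
  #|edges_in A| <= #|edges_in T| + #|edges_in (A :\: T)|.
Proof.
move=> sTA ncr; rewrite -cardsUI (leq_trans _ (leq_addr _ _)) //.
apply/subset_leq_card/subsetP => e; rewrite !inE => /andP[eG].
rewrite eG /=; have [a [b eE]] := edge_pair eG; subst e.
rewrite !subUset !sub1set !inE => /andP[aA bA].
have nab := ncr a b; have nba := ncr b a; move: nab nba.
rewrite (adjC _ b a) /adj /= eG !inE aA bA.
by case: (a \in T) => /=; case: (b \in T) => //=;
  [move=> /(_ isT isT)|move=> _ /(_ isT isT)].
Qed.

Lemma edges_inT A : {in G, forall e : {set V}, e \subset A} -> edges_in A = G.
Proof.
move=> GA; apply/setP => e; rewrite inE; apply/andP/idP => [[]//|eG].
by split=> //; apply: GA.
Qed.

(** Vertices of degree at most [s] are deleted one by one, each costing at most [s] edges. The count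
    is additive to avoid truncated subtraction. *)
Lemma low_degree_core s A : s <= #|A| -> exists C,
  [/\ C \subset A, s <= #|C|, #|edges_in A| + s * #|C| <= #|edges_in C| + s * #|A|
    & #|C| = s \/ {in C, forall v, s < #|nbrs G C v|}].
Proof.
have [n] := ubnP #|A|; elim: n A => // n IHn A ltAn leA.
have [eqA|neqA] := eqVneq #|A| s; first by exists A; split=> //; left.
have [/forall_inP degA|/forall_inPn[v vA]] :=
  boolP [forall v in A, s < #|nbrs G A v|].
  by exists A; split=> //; right.
rewrite -leqNgt => degv; have cA := cardsD1 v A; rewrite vA in cA.
have [||C [sCA leC eC alt]] := IHn (A :\ v); [lia|lia|].
exists C; split=> //; first exact: subset_trans sCA (subD1set _ _).
by have := edges_in_del vA; nia.
Qed.

(** A smallest nonempty subset closed under adjacency in [C] is a connected component. *)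
Lemma closed_component C : C != set0 -> exists C1,
  [/\ C1 \subset C, C1 != set0, cut_connected G C1,
      {in C1, forall v, nbrs G C1 v = nbrs G C v}
    & {in C1 & C :\: C1, forall u v, ~~ adj G u v}].
Proof.
move=> C0; pose cl (D : {set V}) := [&& D \subset C, D != set0 &
  [forall u in D, forall v in C, adj G u v ==> (v \in D)]].
have clC : cl C.
  rewrite /cl subxx C0; apply/forall_inP => u _; apply/forall_inP => v vC.
  by rewrite vC implybT.
case: (@arg_minnP _ C cl (fun D => #|D|) clC) => C1 /and3P[sC1 C10 /forall_inP clC1].
move=> minC1; have clE u v : u \in C1 -> v \in C -> adj G u v -> v \in C1.
  by move=> uC1 vC; apply/implyP/(forall_inP (clC1 u uC1)).
exists C1; split=> //.
- move=> T sTC1 T0 TC1.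
  have [/exists_inP[u uT /exists_inP[v /setDP[vC1 vT] uv]]|nex] :=
    boolP [exists u in T, exists v in C1 :\: T, adj G u v].
    by exists u, v.
  have /minC1 : cl T.
    rewrite /cl (subset_trans sTC1) //= T0; apply/forall_inP => u uT.
    apply/forall_inP => v vC; apply/implyP => uv.
    have vC1 : v \in C1 by apply: clE uv; rewrite ?(subsetP sTC1).
    apply: contraR nex => vT; apply/exists_inP; exists u => //.
    by apply/exists_inP; exists v; rewrite // inE vT.
  by rewrite leqNgt proper_card // properEneq TC1.
- move=> v vC1; apply/setP => z; rewrite !inE.
  apply/andP/andP => -[zC vz]; split=> //; first exact: (subsetP sC1).
  exact: clE vz.
move=> u v uC1 /setDP[vC]; apply: contra; exact: clE.
Qed.

End EdgeCount.

(** A path that is not in [G] uses the added edge exactly once. Cutting it there leaves two paths of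
    [G]; the whole is reversed if the edge is traversed from [v] to [u]. *)
Lemma new_edge_split (V : finType) (G : {set {set V}}) u v w :
  upath ([set u; v] |: G) w -> ~~ sorted (adj G) w ->
  exists A B, [/\ upath G (rcons A u), upath G (v :: B),
    uniq (rcons A u ++ v :: B) & size (rcons A u ++ v :: B) = size w].
Proof.
move=> uw nw.
have [s1 [a [b [s2 [wE nab]]]]] : exists s1 a b s2,
    w = s1 ++ [:: a, b & s2] /\ ~~ adj G a b.
  elim: w nw {uw} => // a [//|b w] IHw /=.
  rewrite negb_and => /orP[nab|/IHw[s1 [c [d [s2 [-> ncd]]]]]].
    by exists [::], a, b, w.
  by exists (a :: s1), c, d, s2.
have sub t z : z \in [set u; v] -> z \notin t -> infix t w -> upath G t.
  move=> zuv zt /infixP[t1 [t2 wE']]; move: uw; rewrite wE' => /andP[so un].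
  apply/andP; split; last by move: un; rewrite !cat_uniq => /and3P[_ _ /andP[]].
  have so' : sorted (adj ([set u; v] |: G)) t.
    by move: (drop_sorted (size t1) so); rewrite drop_size_cat // =>
      /(take_sorted (size t)); rewrite take_size_cat.
  apply: (sub_in_sorted (P := [pred x | x != z])) so' => [x y|].
    rewrite !inE => xz yz /setU1P[xy|//].
    by move: zuv; rewrite -xy !inE !(eq_sym z) (negPf xz) (negPf yz).
  by apply/allP => x xt /=; apply: contraNneq zt => <-.
have ab : adj ([set u; v] |: G) a b.
  by move: uw; rewrite wE => /andP[/(drop_sorted (size s1))];
     rewrite drop_size_cat // => /andP[].
have abE : [set a; b] = [set u; v].
  by case/setU1P: ab => // abG; case/negP: nab.
have unw : uniq w by case/andP: uw.
have aS : a \in [set u; v] by rewrite -abE !inE eqxx.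
have bS : b \in [set u; v] by rewrite -abE !inE eqxx orbT.
have neqab : a != b.
  move: unw; rewrite wE cat_uniq => /and3P[_ _ /=].
  by rewrite inE negb_or => /andP[/andP[]].
have u1 : upath G (rcons s1 a).
  apply: (sub _ b) => //; last first.
    by apply/infixP; exists [::], (b :: s2); rewrite cat_rcons.
  move: unw; rewrite wE -cat_rcons cat_uniq => /and3P[_ + _].
  by rewrite /= negb_or => /andP[].
have u2 : upath G (b :: s2).
  apply: (sub _ a) => //; last first.
    by apply/infixP; exists (rcons s1 a), [::]; rewrite cats0 cat_rcons.
  by move: unw; rewrite wE cat_uniq => /and3P[_ _ /andP[]].
have szw : size w = size (rcons s1 a ++ b :: s2) by rewrite wE cat_rcons.
have un : uniq (rcons s1 a ++ b :: s2) by rewrite cat_rcons -wE.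
have [eau|neau] := eqVneq a u.
  subst a; have ebv : b = v.
    by move: bS; rewrite !inE eq_sym (negPf neqab) => /eqP.
  by subst b; exists s1, s2.
have eav : a = v by move: aS; rewrite !inE (negPf neau) => /eqP.
subst a; have ebu : b = u.
  by move: bS; rewrite !inE orbC eq_sym (negPf neqab) => /eqP.
subst b; exists (rev s2), (rev s1).
rewrite -rev_cons -rev_rcons !upath_rev -rev_cat; split=> //.
  by rewrite rev_uniq.
by rewrite size_rev.
Qed.

Lemma setD_proper (V : finType) (A T : {set V}) :
  T \subset A -> T != set0 -> A :\: T \proper A.
Proof.
move=> sTA /set0Pn[x xT]; apply/properP; split; first exact: subsetDl.
by exists x; rewrite ?(subsetP sTA) // inE xT.
Qed.

(** * Kopylov's proof for edge-maximal graphs *)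

Section FaudreeSchelp.
Variables (V : finType) (s : nat).
Hypothesis s_gt0 : 0 < s.
Notation p := s.*2.+1.
Implicit Types (G H : {set {set V}}) (A C : {set V}).

Let admissible A G := [&& G \subset complete_graph V,
  ~~ contains_copy (path_graph p.+1) G & [forall e in G, e \subset A]].

(** The consequence of edge-maximality that feeds [kopylov]: joining [u] and [v] creates a path on
    [p.+1] vertices, which is then cut at the new edge. *)
Let saturated A G := {in A &, forall u v, u != v -> ~~ adj G u v ->
  exists B1 B2, [/\ upath G (rcons B1 u), upath G (v :: B2),
    uniq (rcons B1 u ++ v :: B2) & p < size (rcons B1 u ++ v :: B2)]}.

Lemma exists_saturated A G : admissible A G ->
  exists H, [/\ admissible A H, saturated A H & #|G| <= #|H|].
Proof.
move=> admG.
case: (@arg_maxnP _ G (admissible A) (fun H => #|H|) admG) => H admH maxH.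
exists H; split=> //; last exact: maxH.
case/and3P: (admH) => sH fH /forall_inP HA u v uA vA neq nuv.
have neH : [set u; v] \notin H by [].
have /negP nadm : ~~ admissible A ([set u; v] |: H).
  apply/negP => /maxH; rewrite cardsU1 neH; lia.
have [cc|nc] := boolP (contains_copy (path_graph p.+1) ([set u; v] |: H)); last first.
  case: nadm; apply/and3P; split=> //.
    rewrite subUset sH andbT sub1set inE cards2 neq //.
  apply/forall_inP => e /setU1P[->|/HA//].
  by rewrite subUset !sub1set uA vA.
case/existsP: cc => f /copy_upath; set w := map f _ => uw.
have szw : size w = p.+1 by rewrite size_map size_enum_ord.
have nso : ~~ sorted (adj H) w.
  apply/negP => so; have : upath H w by rewrite /upath so; case/andP: uw.
  by move/(pfreeP _ _ fH); rewrite szw ltnn.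
have [B1 [B2 [u1 u2 un szE]]] := new_edge_split uw nso.
by exists B1, B2; rewrite szE szw; split.
Qed.

Lemma faudree_schelp_aux n A G : #|A| = n -> G \subset complete_graph V ->
  pfree p G -> {in G, forall e : {set V}, e \subset A} -> #|G| <= fs s n.
Proof.
elim/ltn_ind: n A G => n IHn A G0 cA sG0 fG0 GA0.
have admG0 : admissible A G0.
  by apply/and3P; split=> //; [apply/pfreeP|apply/forall_inP].
have [G [/and3P[sG ncG /forall_inP GA] satG /leq_trans]] := exists_saturated admG0.
apply; move/pfreeP: ncG => fG {G0 sG0 fG0 GA0 admG0}.
have eG : edges_in G A = G by apply: edges_inT.
have IH (T : {set V}) : T \proper A -> #|edges_in G T| <= fs s #|T|.
  move=> /proper_card; rewrite cA => /IHn; apply=> //.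
  - by apply: subset_trans sG; apply/subsetP => e; rewrite inE => /andP[].
  - by apply: pfree_sub fG; apply/subsetP => e; rewrite inE => /andP[].
  - by move=> e; rewrite inE => /andP[].
have [lenp|ltpn] := leqP n p.
  apply: leq_trans (bin_le_fs lenp); rewrite -eG -cA.
  exact: edges_in_le_bin.
have [//|ltfs] := leqP #|G| (fs s n).
(* A disconnected graph splits into two smaller ones, and superadditivity of [fs] gives the
   bound. *)
have conA : cut_connected G A.
  move=> T sTA T0 TA.
  have [/exists_inP[u uT /exists_inP[v /setDP[vA vT] uv]]|nex] :=
    boolP [exists u in T, exists v in A :\: T, adj G u v].
    by exists u, v.
  have ncr : {in T & A :\: T, forall u v, ~~ adj G u v}.
    move=> u v uT vT; apply: contra nex => uv; apply/exists_inP; exists u => //.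
    by apply/exists_inP; exists v.
  have := edges_in_closed sG sTA ncr; rewrite eG.
  have pT : T \proper A by rewrite properEneq TA.
  have pD := setD_proper sTA T0.
  have := IH _ pT; have := IH _ pD; have := fs_superadd s #|T| #|A :\: T|.
  have := cardsID T A; rewrite (setIidPr sTA) cA => ->; lia.
have [|C [sCA leC eC]] := low_degree_core sG (A := A) (s := s); first by lia.
rewrite eG cA in eC; case=> [cC|degC].
  (* A core of [s] vertices leaves [2 * #|G| + s * s.+1 <= 2 * (s * n)], so [fs_ge] suffices. *)
  have := edges_in_le_bin sG C; have := bin2_double s; have := fs_ge s n.
  by rewrite cC; nia.
have C0 : C != set0 by rewrite -card_gt0; lia.
have [C1 [sC1 C10 conC1 nbC1 clC1]] := closed_component G C0.
have degC1 : {in C1, forall v, s < #|nbrs G C1 v|}.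
  by move=> v vC1; rewrite nbC1 //; apply: degC; apply: (subsetP sC1).
have sC1A := subset_trans sC1 sCA.
have dirac S : cut_connected G S -> {in S, forall v, s < #|nbrs G S v|} ->
    #|S| <= p.
  move=> conS degS; rewrite leqNgt; apply/negP => ltp.
  have [||w [uw szw _]] := dirac_path sG conS (m := p.+1); first by rewrite ltp.
    by move=> v /degS; lia.
  by have := fG w uw; rewrite szw ltnn.
have lec1 := dirac _ conC1 degC1.
have GinA u v : adj G u v -> u \in A.
  by move=> /GA; rewrite subUset !sub1set => /andP[].
(* By induction the rest of the core has at most [s] edges per vertex, so the core estimate passes
   to [C1]. *)
have e1 : #|G| + s * #|C1| <= 'C(#|C1|, 2) + s * n.
  have := edges_in_closed sG sC1 clC1; have := edges_in_le_bin sG C1.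
  have pD : C :\: C1 \proper A.
    exact: proper_sub_trans (setD_proper sC1 C10) sCA.
  have := IH _ pD; have := fs_le s #|C :\: C1|.
  have := cardsID C1 C; rewrite (setIidPr sC1); nia.
(* A non-adjacent pair would lead, by [kopylov], to two disjoint neighborhoods in [C1] with more
   than [s] vertices each, against [#|C1| <= p]. *)
have cliC1 : clique G C1.
  move=> u v uC1 vC1 neq; apply/negPn/negP => nuv.
  have [||||u' [v' [B1 [B2 [uC' vC' un [uB2 sub1 sub2]]]]]] :=
    kopylov sG (X := C1) (Y := C1) (d1 := s.+1) (d2 := s.+1) fG.
  - by clear; lia.
  - exact: degC1.
  - exact: degC1.
  - have [||B1 [B2 [? ? ? ?]]] := satG u v _ _ neq nuv;
      rewrite ?(subsetP sC1A) //.
    by exists u, v, B1, B2.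
  have dis : nbrs G C1 u' :&: nbrs G C1 v' = set0.
    apply/setP => z; rewrite in_setI in_set0; apply/negP => /andP[/sub1 z1 /sub2 z2].
    move: un; rewrite cat_uniq => /and3P[_ /hasPn/(_ z)].
    by rewrite inE z2 orbT mem_rcons inE z1 orbT => /(_ isT).
  have sub : nbrs G C1 u' :|: nbrs G C1 v' \subset C1.
    by apply/subsetP => z; rewrite !inE => /orP[] /andP[].
  have := subset_leq_card sub; rewrite cardsU dis cards0.
  move: (degC1 _ uC') (degC1 _ vC') lec1; clear.
  by move: #|nbrs G C1 u'| #|nbrs G C1 v'| #|C1| => a b c; lia.
have ltc1 : s < #|C1|.
  case/set0Pn: C10 => z zC1; apply: leq_trans (degC1 z zC1) _.
  by apply/subset_leq_card/subsetP => y /setIdP[].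
have [q Eq] : exists q, q + #|C1| = p by exists (p - #|C1|); lia.
have [v vA degv] : exists2 v, v \in A & #|nbrs G A v| <= q.
  apply/exists_inP; apply: contraT => /exists_inPn degA.
  have {}degA : {in A, forall v, q < #|nbrs G A v|}.
    by move=> v /degA; rewrite -ltnNge.
  (* If [C1] is completely joined to the rest, all degrees exceed [s] and [dirac] gives [n <= p].
     Otherwise [#|C1|.-1] and [q.+1] add up to [p], and [kopylov] separates [C1] from a cycle on
     more than [q.+1] vertices; clique and cycle then lie on too long a path. *)
  have [/exists_inP[u uC1 /exists_inP[v /setDP[vA vC1] nuv]]|nex] :=
    boolP [exists u in C1, exists v in A :\: C1, ~~ adj G u v]; last first.
    suff /(dirac _ conA) : {in A, forall v, s < #|nbrs G A v|} by rewrite cA; lia.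
    move=> v vA; have [vC1|vC1] := boolP (v \in C1).
      apply: leq_trans (degC1 v vC1) _; apply/subset_leq_card/subsetP => y.
      by rewrite !inE => /andP[/(subsetP sC1A)-> ->].
    apply: leq_trans ltc1 _; apply/subset_leq_card/subsetP => y yC1.
    rewrite inE (subsetP sC1A) //=; apply: contraR nex => nvy.
    apply/exists_inP; exists y => //; apply/exists_inP; exists v.
      by rewrite inE vC1.
    by rewrite adjC.
  have neq : u != v by apply: contraNneq vC1 => <-.
  have [||||u' [v' [B1 [B2 [uC' vA' un [uB2 sub1 sub2]]]]]] :=
    kopylov sG (X := C1) (Y := A) (d1 := #|C1|.-1) (d2 := q.+1) fG.
  - by move: Eq ltc1; clear; move: #|C1| => m; lia.
  - move=> z zC1; have := cardsD1 z C1; rewrite zC1 => ->; rewrite subset_leq_card //.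
    apply/subsetP => y /setD1P[yz yC1]; rewrite inE yC1 cliC1 //.
    by rewrite eq_sym.
  - exact: degA.
  - have [B1 [B2 [? ? ? ?]]] := satG u v (subsetP sC1A _ uC1) vA neq nuv.
    by exists u, v, B1, B2.
  have gt0 : 0 < #|nbrs G A v'| by exact: leq_ltn_trans (leq0n q) (degA _ vA').
  have [K [uK cyK sK vK szK]] := last_nbr_cycle uB2 sub2 gt0.
  have dis : ~~ has (mem C1) K.
    apply/hasPn => z /sK zB; apply/negP => /= zC1.
    move: un; rewrite cat_uniq => /and3P[_ /hasPn/(_ z zB) + _].
    rewrite /= mem_rcons inE; have [//|zu] := eqVneq z u'.
    by rewrite sub1 // inE zC1 cliC1 // eq_sym.
  have hK : has (mem A) K by apply/hasP; exists v'.
  have [w [uw szw]] := clique_cycle_path conA sC1A cliC1 C10 uK cyK dis hK.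
  move: (fG w uw) (degA _ vA') szw szK Eq; clear.
  by move: (size w) (size K) #|nbrs G A v'| #|C1| => a b c d; lia.
have := edges_in_del sG vA; rewrite eG.
have := IH _ (properD1 vA); have := cardsD1 v A; rewrite vA cA.
move: ltfs e1 lec1 ltc1 Eq degv; have := bin2_double #|C1|; clear.
move: #|nbrs G A v| #|edges_in G (A :\ v)| #|G| #|C1| #|A :\ v| 'C(_, 2).
move=> dv eD e c m b; case: n => [|n] // Eb ltfs e1 lec1 ltc1 Eq degv nE.
have -> : m = n by lia.
move=> leD eDel.
have := fsS s n; have := fs_double s n.+1.
(* If [q] is at most the residue, deleting [v] suffices. Otherwise [e1] bounds twice the number [e]
   of edges by [2 * (s * n.+1) - q * c], and [q * c] is at least the defect of [n.+1]. *)
have [|ltm] := leqP q (n %% p); first by lia.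
have -> : n.+1 %% p = (n %% p).+1.
  by rewrite -addn1 -modnDml addn1 modn_small //; lia.
move: (n %% p) ltm => r ltr Efs _.
have cE : p - q = c by lia.
have le_rq : r.+1 * (p - r.+1) <= q * c.
  have [d dE] : exists d, q = r.+1 + d by exists (q - r.+1); lia.
  have -> : p - r.+1 = c + d by lia.
  rewrite mulnDr [in leqRHS]dE mulnDl leq_add2l mulnC leq_mul //; lia.
have Ec : c * c.-1 + q * c = 2 * (s * c).
  rewrite [q * c]mulnC -mulnDr.
  have -> : c.-1 + q = 2 * s by lia.
  by rewrite mulnC mulnA.
move: Efs le_rq Eb Ec e1 ltfs; clear.
move: (r.+1 * _) (q * c) (c * c.-1) (s * c) (s * n.+1) (fs s n.+1).
by move=> *; lia.
Qed.

End FaudreeSchelp.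

(** * Upper bound *)

Theorem faudree_schelp (V : finType) (s : nat) (A : {set V}) (G : {set {set V}}) :
  0 < s -> G \subset complete_graph V -> pfree s.*2.+1 G ->
  {in G, forall e : {set V}, e \subset A} -> #|G| <= fs s #|A|.
Proof. by move=> s0; apply: faudree_schelp_aux. Qed.

Lemma pigeonhole (T K : finType) (X : {set T}) (f : T -> K) (R : {set K}) L :
  {in X, forall x, f x \in R} -> L * #|R| < #|X| ->
  exists2 y, y \in R & L < #|[set x in X | f x == y]|.
Proof.
move=> fR; rewrite ltnNge => /negP big; apply/exists_inP; apply: contraT.
move=> /exists_inPn small; case: big.
rewrite -sum1_card (partition_big f [in R]) //= mulnC -sum_nat_const.
apply: leq_sum => y /small; rewrite -leqNgt; apply: leq_trans.
by rewrite -sum1_card; under [leqRHS]eq_bigl do rewrite inE.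
Qed.

Lemma exists_subset_card (T : finType) (A : {set T}) m : m <= #|A| ->
  exists B : {set T}, B \subset A /\ #|B| = m.
Proof.
rewrite -bin_gt0 -cards_draws => /card_gt0P[B].
by rewrite inE => /andP[sBA /eqP cB]; exists B.
Qed.

Section Zigzag.
Variables (V : finType) (G : {set {set V}}).

Fixpoint zigzag (a b : seq V) : seq V :=
  match a, b with
  | x :: a', y :: b' => [:: x, y & zigzag a' b']
  | _, _ => [::]
  end.

Lemma size_zigzag a b : size a = size b -> size (zigzag a b) = (size a).*2.
Proof. by elim: a b => [|x a IHa] [|y b] //= [/IHa->]. Qed.

Lemma perm_zigzag a b : size a = size b -> perm_eq (zigzag a b) (a ++ b).
Proof.
elim: a b => [|x a IHa] [|y b] //= [/IHa pab].
by rewrite perm_cons -(cat1s y b) perm_sym perm_catCA perm_cons perm_sym.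
Qed.

Lemma zigzag_upath a b : size a = size b -> uniq (a ++ b) ->
  {in a & b, forall x y, adj G x y} -> upath G (zigzag a b).
Proof.
move=> szab uab adjab; rewrite /upath (perm_uniq (perm_zigzag szab)) uab andbT.
elim: a b szab adjab {uab} => [|x a IHa] [|y b] //= [szab] adjab.
have := IHa b szab (fun u v ua vb => adjab u v
  (mem_behead (s := x :: a) ua) (mem_behead (s := y :: b) vb)).
have xy := adjab x y (mem_head _ _) (mem_head _ _).
case: a b szab adjab {IHa} => [|x' a] [|y' b] //= _ adjab.
  by rewrite andbT.
move=> ->; rewrite andbT; apply/andP; split=> //; apply/eqP/eqP.
by have := adjab x' y; rewrite adjC; apply; rewrite !inE eqxx ?orbT.
Qed.
End Zigzag.

(** * NIM-edges of one color and forbidden start vertices *)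

Section Coloring.
Variables (V : finType) (s : nat) (c : {ffun {set V} -> 'I_s.*2.+2}).
Hypothesis s_gt0 : 0 < s.
Notation p := s.*2.+1.
Notation Q := s.*2.+2.
Implicit Types (x y t v : V) (i j : 'I_Q) (T X Y : {set V}).

Let NIM := NIM_edges (path_graph Q) c.

Definition nim_color i : {set {set V}} := [set e in NIM | c e == i].

Definition nim_vertices i : {set V} := cover (nim_color i).

Lemma color_class_simple i : color_class c i \subset complete_graph V.
Proof. by apply/subsetP => e; rewrite inE => /andP[]. Qed.

Lemma color_adj i x y : x != y -> c [set x; y] = i -> adj (color_class c i) x y.
Proof. by move=> neq ci; rewrite /adj /= !inE cards2 neq ci eqxx. Qed.

Lemma nim_color_sub i : nim_color i \subset color_class c i.
Proof.
by apply/subsetP => e; rewrite !inE => /andP[/andP[-> _] ->].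
Qed.

Lemma nim_not_on_path i s1 u v s2 :
  upath (color_class c i) (s1 ++ [:: u, v & s2]) ->
  size (s1 ++ [:: u, v & s2]) = Q -> [set u; v] \notin NIM.
Proof.
move=> us sz; rewrite inE negb_and negbK; apply/orP; right.
by apply/existsP; exists i; apply/copy_edgesP; exists s1, u, v, s2.
Qed.

Lemma nim_color_pfree i : pfree p (nim_color i).
Proof.
move=> w uw; rewrite leqNgt; apply/negP => ltp.
have := upath_take Q uw; have : size (take Q w) = Q by rewrite size_takel.
case: (take Q w) => [|a [|b w']] // sz uab.
have /negP[] := nim_not_on_path (s1 := [::]) (upath_sub (nim_color_sub i) uab) sz.
by case/andP: uab => /andP[+ _] _; rewrite /adj /= inE => /andP[].
Qed.

(** The Faudree-Schelp bound is applied inside [nim_vertices i], so that a small set forces few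
    edges. *)
Lemma card_nim_color i : #|nim_color i| <= s * #|nim_vertices i|.
Proof.
apply: leq_trans (fs_le s _); apply: faudree_schelp => //.
- exact: subset_trans (nim_color_sub i) (color_class_simple i).
- exact: nim_color_pfree.
by move=> e eN; apply: bigcup_sup eN.
Qed.

Lemma card_NIM : #|NIM| = \sum_i #|nim_color i|.
Proof.
rewrite -sum1_card (partition_big c xpredT) //=; apply: eq_bigr => i _.
by rewrite -sum1_card; apply: eq_bigl => e; rewrite [in RHS]inE.
Qed.

(* A NIM-edge [xu] of color [i] could be inserted into the path: in front of
   [x] if [u] is not on the path, and otherwise by reversing the part of the
   path that precedes [u]. *)
Lemma path_head_not_nim i x w : upath (color_class c i) (x :: w) ->
  size w = p -> x \notin nim_vertices i.
Proof.
move=> ux szw; apply/negP => /bigcupP[e eN xe].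
have eC := subsetP (nim_color_sub i) e eN.
have [u' [v' eE]] := edge_pair (color_class_simple i) eC.
have [u {u' v'} {}eE] : exists u, e = [set x; u].
  move: xe; rewrite eE !inE => /orP[/eqP->|/eqP->]; first by exists v'.
  by exists u'; rewrite setUC.
have xu : adj (color_class c i) x u by rewrite /adj /= -eE.
have eNIM : [set x; u] \in NIM by move: eN; rewrite eE inE => /andP[].
have [/splitPr uw|uw] := boolP (u \in w).
  case: uw ux szw => w1 w2 ux szw.
  suff : upath (color_class c i) (rev w1 ++ [:: x, u & w2]).
    move=> uw; apply: (negP (nim_not_on_path uw _) eNIM).
    by move: szw; rewrite !size_cat size_rev /= => <-; rewrite addnS.
  rewrite -cat_rcons; apply: (upath_cat _ _ _ xu).
  - by rewrite -rev_cons upath_rev;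
       have := upath_take (size w1).+1 ux; rewrite /= take_size_cat.
  - case/andP: ux => so un; apply/andP; split.
      by have := drop_sorted (size w1).+1 so; rewrite /= drop_size_cat.
    by move: un; rewrite -cat_cons cat_uniq => /and3P[].
  - rewrite -rev_cons; case/andP: ux => _; rewrite -cat_cons => un.
    by rewrite (perm_uniq (s2 := (x :: w1) ++ u :: w2)) // perm_cat2r perm_rev.
have : upath (color_class c i) [:: u, x & take s.*2 w].
  rewrite upath_cons adjC xu /=; apply/andP; split.
    rewrite inE negb_or eq_sym (adj_neq (color_class_simple i) xu) /=.
    by apply: contra uw; apply: mem_take.
  exact: (upath_take Q.-1 ux).
move=> uw'; rewrite setUC in eNIM.
apply: (negP (nim_not_on_path (s1 := [::]) uw' _) eNIM).
by rewrite /= size_takel // szw.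
Qed.

(** Otherwise each of the [Q] colors has at most [s * #|Y|] edges inside [Y], too few to cover all
    pairs. *)
Lemma mono_path Y : Q ^ 2 <= #|Y| -> exists i w,
  [/\ upath (color_class c i) w, size w = Q & {subset w <= Y}].
Proof.
move=> leY; pose G i := [set e in color_class c i | e \subset Y].
have [/existsP[i /existsP[f /copy_upath]]|/existsPn fG] :=
  boolP [exists i, contains_copy (path_graph Q) (G i)].
  set w := map f _ => uw; exists i, w; split.
  - by apply: upath_sub uw; apply/subsetP => e; rewrite inE => /andP[].
  - by rewrite size_map size_enum_ord.
  have szw : size w = Q by rewrite size_map size_enum_ord.
  case: w szw uw => [|a [|b w]] // _ /andP[sow _].
  have edgeY x y : adj (G i) x y -> (x \in Y) && (y \in Y).
    by rewrite /adj /= inE => /andP[_]; rewrite subUset !sub1set.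
  have pathY x w' : x \in Y -> path (adj (G i)) x w' -> {subset x :: w' <= Y}.
    elim: w' x => [|y w' IHw] x xY /=; first by move=> _ z; rewrite inE => /eqP->.
    case/andP=> /edgeY/andP[_ yY] /(IHw _ yY) sub z.
    by rewrite inE => /orP[/eqP->|/sub].
  have aY : a \in Y by case/andP: (sow) => /edgeY/andP[].
  exact: pathY aY sow.
exfalso; have : 'C(#|Y|, 2) <= Q * (s * #|Y|).
  rewrite -cards_draws -sum1_card (partition_big c xpredT) //=.
  rewrite -[X in X * _]card_ord -sum_nat_const; apply: leq_sum => i _.
  apply: leq_trans (fs_le s _); rewrite sum1dep_card.
  apply: (@leq_trans #|G i|).
    apply/subset_leq_card/subsetP => e; rewrite !inE.
    by case/andP=> /andP[-> ->] ->.
  apply: faudree_schelp => //.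
  - by apply: subset_trans (color_class_simple i); apply/subsetP => e;
       rewrite inE => /andP[].
  - by apply/pfreeP.
  - by move=> e; rewrite inE => /andP[].
have := bin2_double #|Y|; move: leY; clear -s_gt0.
move: #|Y| 'C(_, 2) => y b leY Eb leb.
have : y * y.-1 <= y * (2 * (Q * s)) by nia.
rewrite leq_pmul2l; last by nia.
by rewrite expnS expn1 in leY; nia.
Qed.

(** The alternatives serve two contradictions: with [T] inside every [nim_vertices j] no [t] can
    exist, and with [T] inside the only one that [y] misses, the second alternative makes [y] miss
    another. *)
Lemma homogeneous_set T X : [disjoint T & X] -> #|T| = (s * p).+1 ->
  Q ^ 2 * Q ^ (s * p).+1 < #|X| ->
  exists y j, [/\ y \in X, y \notin nim_vertices j &
    (exists2 t, t \in T & t \notin nim_vertices j) \/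
    (exists i t, [/\ i != j, t \in T, t \notin nim_vertices i
                   & y \notin nim_vertices i])].
Proof.
move=> disTX cT ltX.
(* The colors from [y] to [T]; the constant value outside [T] limits the patterns to [Q ^ #|T|]. *)
pose pat y := [ffun t => if t \in T then c [set t; y] else ord0].
have [|/=|g _ ltY] := @pigeonhole _ _ X pat
    [set g in pffun_on ord0 (mem T) predT] (Q ^ 2).
- move=> y _; rewrite inE; apply/pffun_onP; split.
    by apply/subsetP => t; rewrite inE ffunE; case: (t \in T); rewrite ?eqxx.
  by [].
- by rewrite cardsE card_pffun_on cT card_ord.
set Y := [set y in X | _] in ltY.
have sYX : {subset Y <= X} by move=> y /setIdP[].
have TY t y : t \in T -> y \in Y -> t != y.
  by move=> tT /sYX yX; apply: contraTneq tT => ->; rewrite (disjointFl disTX).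
have adjTY t y : t \in T -> y \in Y -> adj (color_class c (g t)) t y.
  move=> tT yY; apply: color_adj; first exact: TY.
  by case/setIdP: yY => _ /eqP <-; rewrite ffunE tT.
have [j [w [uw szw wY]]] := mono_path (ltnW ltY).
case: w uw szw wY => [|y w] // uw [szw] wY.
have yY : y \in Y by apply: wY; rewrite mem_head.
exists y, j; split; [exact: sYX|exact: path_head_not_nim uw szw|].
(* If [t] is joined to [Y] in color [j], it goes in front of the path and the last vertex is
   dropped. *)
have [/existsP[t /andP[tT /eqP gt]]|/existsPn ng] :=
    boolP [exists t, (t \in T) && (g t == j)]; [left|right].
  exists t => //; apply: (path_head_not_nim (w := take p (y :: w))).
    rewrite /= upath_cons -{1}gt adjTY //=; apply/andP; split.
      apply/negP; rewrite inE => tw; have tY : t \in Y.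
        case/orP: tw => [/eqP->//|/mem_take tw].
        by apply: wY; rewrite inE tw orbT.
      by have := TY t t tT tY; rewrite eqxx.
    exact: (upath_take p uw).
  by rewrite size_takel //= szw.
(* Only the [p] colors other than [j] occur on [T], so [s.+1] of its vertices share a color [i].
   With [s.+1] vertices of [Y] they span a complete bipartite graph, whose alternating paths may
   start on either side. *)
have [||i] := @pigeonhole _ _ T g [set~ j] s.
- by move=> t tT; have := ng t; rewrite tT !inE.
- by rewrite cardsC1 card_ord cT.
rewrite !inE => neij ltF; set F := [set t in T | _] in ltF.
have [F' [sF' cF']] := exists_subset_card ltF.
have leY : s <= #|Y :\ y|.
  have := cardsD1 y Y; rewrite yY; move: ltY; clear.
  by move: #|Y| #|Y :\ y| => a b; rewrite expnS expn1 add1n => *; nia.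
have [Y' [sY' cY']] := exists_subset_card leY.
have szF : size (enum F') = s.+1 by rewrite -cardE.
have [t [tl tE]] : exists t tl, enum F' = t :: tl.
  by case: (enum F') szF => // t tl; exists t, tl.
pose yl := y :: enum Y'.
have szyl : size yl = s.+1 by rewrite /= -cardE cY'.
have ylY z : z \in yl -> z \in Y.
  rewrite inE mem_enum => /orP[/eqP->//|/(subsetP sY')].
  by rewrite inE => /andP[].
have tlT z : z \in enum F' -> z \in T /\ g z = i.
  by rewrite mem_enum => /(subsetP sF'); rewrite inE => /andP[? /eqP].
have ufy : uniq (enum F' ++ yl).
  rewrite cat_uniq enum_uniq; apply/and3P; split=> //; last first.
    rewrite cons_uniq enum_uniq mem_enum andbT.
    by apply/negP => /(subsetP sY'); rewrite !inE eqxx.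
  apply/hasPn => z zyl; apply/negP => /= /tlT[zT _].
  by have := TY z z zT (ylY z zyl); rewrite eqxx.
have adjFy : {in enum F' & yl, forall a b, adj (color_class c i) a b}.
  by move=> a b /tlT[aT <-] /ylY; apply: adjTY.
have tF : t \in enum F' by rewrite tE mem_head.
exists i, t; split=> //; first by case: (tlT t tF).
  apply: (path_head_not_nim (w := behead (zigzag (enum F') yl))).
    have := zigzag_upath (etrans szF (esym szyl)) ufy adjFy.
    by rewrite tE.
  by rewrite size_behead size_zigzag ?szF.
apply: (path_head_not_nim (w := behead (zigzag yl (enum F')))).
  have : upath (color_class c i) (zigzag yl (enum F')).
    apply: zigzag_upath; rewrite ?szF ?szyl // 1?uniq_catC //.
    by move=> a b ayl bF; rewrite adjC; apply: adjFy.
  by rewrite tE.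
by rewrite size_behead size_zigzag ?szF ?szyl.
Qed.

End Coloring.

(** With [Q = s.*2.+2] and [P = (s * s.*2.+1).+1], [B] is [Q ^ (P + 2)], while
    [P + 4 <= 2 * s.+1 ^ 2] gives [Q ^ (P + 4) <= n]; the spare factor [Q ^ 2] absorbs the other
    terms. *)
Lemma size_bounds s n : 0 < s -> s.*2.+2 ^ (2 * s.+1 ^ 2) <= n ->
  let B := s.*2.+2 ^ 2 * s.*2.+2 ^ (s * s.*2.+1).+1 in
  B < n - (s * s.*2.+1).+1 /\
  B * s.*2.+2 + (s * s.*2.+1 + s.*2.+1 * s.+1) < n.
Proof.
move=> s0 hn; set P := (s * s.*2.+1).+1.
have le4 : P + 4 <= 2 * s.+1 ^ 2.
  by rewrite /P expnS expn1 -mul2n; nia.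
have leqn := leq_trans (leq_pexp2l (ltn0Sn _) le4) hn.
have ltPE : P < s.*2.+2 ^ P by apply: ltn_expl.
have le4q : 4 <= s.*2.+2 by lia.
have ltxa : s * s.*2.+1 + s.*2.+1 * s.+1 < s.*2.+2 ^ 2.
  by rewrite expnS expn1; nia.
move: (s * _ + _) ltxa => x; rewrite expnD in leqn; clear hn le4.
move: P (s.*2.+2) ltPE le4q leqn => {s s0} P q ltPE le4q leqn ltxa.
have leqa : q * 4 <= q ^ 2 by rewrite expnS expn1 leq_mul2l le4q orbT.
rewrite (expnD q 2 2) in leqn; move: (q ^ P) ltPE leqn => E ltPE leqn.
move: (q ^ 2) leqa ltxa leqn => a leqa ltxa; rewrite mulnA [E * a]mulnC => leFn.
have leE : E <= a * E by rewrite leq_pmull //; lia.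
have lea : a <= a * E by rewrite leq_pmulr //; lia.
rewrite /=; move: (a * E) leE lea leFn => F leE lea leFn.
have le1 : F * (q * 4) <= F * a by rewrite leq_mul2l leqa orbT.
have le2 : F * 4 <= F * q by rewrite leq_mul2l le4q orbT.
rewrite mulnA in le1; move: (F * q) (F * a) le1 le2 leFn => Fq Fa le1 le2 leFn.
by split; lia.
Qed.

(** * Counting the vertices that miss a color *)

Section UpperBound.
Variables (V : finType) (s : nat) (c : {ffun {set V} -> 'I_s.*2.+2}).
Hypothesis s_gt0 : 0 < s.
Notation p := s.*2.+1.
Notation Q := s.*2.+2.
Notation W := (nim_vertices c).
Hypothesis large : Q ^ (2 * s.+1 ^ 2) <= #|V|.

Let U := [set v | [forall i, v \in W i]].
Let Z := [set v | 1 < #|[set i | v \notin W i]|].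
Let B := Q ^ 2 * Q ^ (s * p).+1.

Lemma card_U : #|U| <= s * p.
Proof.
rewrite leqNgt; apply/negP => /exists_subset_card[T [sTU cT]].
have inW t i : t \in T -> t \in W i.
  by move=> /(subsetP sTU); rewrite inE => /forallP.
have [||y [j [_ _]]] := homogeneous_set c s_gt0 (T := T) (X := ~: T) _ cT.
- by rewrite -setI_eq0 setICr.
- by rewrite cardsCs setCK cT; case: (size_bounds s_gt0 large).
by case=> [[t tT]|[i [t [_ tT]]]]; rewrite inW.
Qed.

Lemma card_common_missing j : B < #|~: (W j :|: Z)| -> #|W j| <= s * p.
Proof.
move=> ltB; rewrite leqNgt; apply/negP => /exists_subset_card[T [sTW cT]].
have [||y [j' [yX yj']]] :=
  homogeneous_set c s_gt0 (T := T) (X := ~: (W j :|: Z)) _ cT.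
- rewrite disjoint_sym disjoints_subset setCS.
  exact: subset_trans sTW (subsetUl _ _).
- exact: ltB.
move: yX; rewrite !inE negb_or -leqNgt => /andP[yj yZ].
have uniqj i : y \notin W i -> i = j.
  move=> yi; apply: contraTeq yZ => neq; rewrite -ltnNge.
  by apply/card_gt1P; exists i, j; rewrite !inE.
have -> := uniqj _ yj'.
case=> [[t tT]|[i [t [neq _ _ yi]]]]; first by rewrite (subsetP sTW).
by rewrite (uniqj _ yi) eqxx in neq.
Qed.

(** Double counting: a vertex of [U] lies in [p.+1] of the sets [W i], one of [Z] in at most [p.-1],
    and any other in [p]. *)
Lemma sum_nim_vertices : \sum_i #|W i| + #|Z| <= p * #|V| + #|U|.
Proof.
have -> : \sum_i #|W i| = \sum_v #|[set i | v \in W i]|.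
  under eq_bigr do rewrite -sum1_card big_mkcond.
  by rewrite exchange_big /=; apply: eq_bigr => v _;
     rewrite -big_mkcond sum1dep_card.
have cE (A : {set V}) : #|A| = \sum_v (v \in A).
  by rewrite -sum1_card big_mkcond; apply: eq_bigr => v _; case: (v \in A).
rewrite (cE Z) (cE U) mulnC -sum_nat_const -!big_split /=.
apply: leq_sum => v _.
rewrite !inE; have := cardsC [set i | v \in W i]; rewrite card_ord.
have -> : ~: [set i | v \in W i] = [set i | v \notin W i].
  by apply/setP => i; rewrite !inE.
have [_|/forallPn[i vi]] := boolP [forall i, v \in W i].
  by move: #|_| #|_| => a b; case: ltnP; lia.
have : 0 < #|[set i | v \notin W i]| by apply/card_gt0P; exists i; rewrite inE.
by move: #|_| #|_| => a b; case: ltnP; lia.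
Qed.

Lemma nim_upper_bound ex :
  (forall i, #|nim_color c i| <= ex) -> 2 * (s * #|V|) <= 2 * ex + s * s.+1 ->
  #|NIM_edges (path_graph Q) c| <= p * ex + s * (s * p).
Proof.
move=> leex exge; rewrite card_NIM.
(* A [Z] of this size saves [s * (p * s.+1)] edges, which exceeds the gap between [p * (s * #|V|)]
   and [p * ex]; the term [s * (s * p)] pays for [U]. *)
have [leZ|ltZ] := leqP (p * s.+1) #|Z|.
  apply: (@leq_trans (s * \sum_i #|W i|)).
    by rewrite big_distrr /=; apply: leq_sum => i _; apply: card_nim_color.
  have := sum_nim_vertices; have := card_U; move: leZ exge s_gt0; clear.
  move: #|U| #|Z| #|V| (\sum_i _) => u z n S; nia.
(* Vertices outside [U] and [Z] miss exactly one color, so the default [ord0] is never taken for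
   them; some [j] is missed by more than [B] of them. *)
have [||j _ ltF] := @pigeonhole _ _ (~: (U :|: Z))
  (fun v => odflt ord0 [pick i | v \notin W i]) setT B.
- by [].
- rewrite cardsT card_ord.
  have [_] := size_bounds s_gt0 large; rewrite -/B.
  have := cardsC (U :|: Z); have := card_U; move: ltZ.
  have : #|U :|: Z| <= #|U| + #|Z| by rewrite cardsU leq_subr.
  move: (B * Q) => BQ; clear; move: #|U :|: Z| #|~: _| #|U| #|Z| #|V|.
  by move=> *; lia.
have Wj : #|W j| <= s * p.
  apply: card_common_missing; apply: leq_trans ltF _.
  apply/subset_leq_card/subsetP => v; rewrite !inE => /andP[].
  rewrite !negb_or => /andP[/forallPn[i vi] ->]; rewrite andbT.
  by case: pickP => [i' vi' /eqP <- //|/(_ i)]; rewrite vi.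
rewrite (bigD1 j) //= addnC leq_add //.
  apply: leq_trans (leq_sum _ (fun i _ => leex i)) _.
  by rewrite sum_nat_const cardC1 card_ord.
by apply: leq_trans (card_nim_color c s_gt0 j) _; rewrite leq_mul2l Wj orbT.
Qed.

End UpperBound.

(** * Upper and lower bounds on the Turán number *)

Section Turan.
Variables (s n : nat).
Notation p := s.*2.+1.

Lemma turan_number_le : 0 < s -> turan_number n (path_graph p.+1) <= fs s n.
Proof.
move=> s0; apply/bigmax_leqP => G /andP[sG /pfreeP fG].
rewrite -[n in fs s n]card_ord -cardsT; exact: faudree_schelp.
Qed.

Lemma leq_turan_number (G : {set {set 'I_n}}) :
  G \subset complete_graph 'I_n -> pfree p G ->
  #|G| <= turan_number n (path_graph p.+1).
Proof.
move=> sG fG; apply: (leq_bigmax_cond (P := fun G : {set {set 'I_n}} =>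
  (G \subset complete_graph 'I_n) && ~~ contains_copy (path_graph p.+1) G)
  (F := fun G : {set {set 'I_n}} => #|G|)).
by rewrite sG; apply/pfreeP.
Qed.

End Turan.

(** Of two consecutive vertices of the path, one lies in [S]. *)
Lemma path_vertex_cover (V : finType) (G : {set {set V}}) (S : {set V}) w :
  {in w &, forall x y, adj G x y -> (x \in S) || (y \in S)} ->
  upath G w -> size w <= #|S|.*2.+1.
Proof.
move=> cov uw; have : size w <= (count (mem S) w).*2.+1.
  case/andP: uw => + _; have [m] := ubnP (size w).
  elim: m w cov => // m IHm [|x [|y w]] // cov ltm /andP[xy so].
  have covw : {in w &, forall x y, adj G x y -> (x \in S) || (y \in S)}.
    by move=> a b aw bw; apply: cov; rewrite !inE ?aw ?bw !orbT.
  have := IHm w covw; rewrite (path_sorted so) => /(_ _ isT).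
  have := cov x y; rewrite !inE !eqxx orbT => /(_ isT isT xy).
  by move: ltm => /=; case: (x \in S); case: (y \in S) => //=; lia.
move=> /leq_trans; apply; rewrite ltnS leq_double -size_filter cardE.
apply: uniq_leq_size => [|z]; first by case/andP: uw => _; apply: filter_uniq.
by rewrite mem_filter mem_enum => /andP[].
Qed.

Definition touching (V : finType) (S : {set V}) : {set {set V}} :=
  [set e in complete_graph V | e :&: S != set0].

Lemma card_touching (V : finType) (S : {set V}) :
  #|touching S| + 'C(#|V| - #|S|, 2) = 'C(#|V|, 2).
Proof.
have -> : #|V| - #|S| = #|~: S| by rewrite [RHS]cardsCs setCK.
rewrite -cards_draws -(card_draws V).
rewrite -[RHS](cardsID [set e : {set V} | e :&: S != set0]).
congr (_ + _); apply: eq_card => e; rewrite !inE //.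
by rewrite negbK setI_eq0 disjoints_subset.
Qed.

(** The join of a clique on [s] vertices with an independent set: the clique covers all edges, so no
    path has more than [s.*2.+1] vertices. *)
Lemma turan_number_ge s n : s <= n ->
  2 * (s * n) <= 2 * turan_number n (path_graph s.*2.+2) + s * s.+1.
Proof.
move=> lesn; have [|S [_ cS]] := @exists_subset_card 'I_n setT s.
  by rewrite cardsT card_ord.
have : #|touching S| <= turan_number n (path_graph s.*2.+2).
  apply: leq_turan_number; first by apply/subsetP => e; rewrite inE => /andP[].
  move=> w uw; rewrite -[s in s.*2]cS; apply: path_vertex_cover uw.
  move=> x y _ _; rewrite /adj /= inE => /andP[_ /set0Pn[z]]; rewrite !inE.
  by case/andP=> /orP[]/eqP-> ->; rewrite ?orbT.
have := card_touching S; rewrite card_ord cS.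
have := bin2_double n; have := bin2_double (n - s).
move: (turan_number _ _) #|touching S| => t m; rewrite -(subnKC lesn) addKn.
move: (n - s) => d; move: 'C(_, 2) 'C(_, 2) => x y.
case: d => [|d]; first by rewrite muln0 addn0; nia.
by rewrite addnS /=; nia.
Qed.

(** * Affine plane coloring *)

Import GRing.Theory.

(** From a vertex of [L] the path can be followed in both directions without leaving [L]. *)
Lemma trapped_path (V : finType) (G : {set {set V}}) (L : {set V}) w :
  {in L, forall x y, adj G x y -> y \in L} -> upath G w -> has (mem L) w ->
  size w <= #|L|.
Proof.
move=> clL uw hL; have clp x w' : x \in L -> path (adj G) x w' -> {subset w' <= L}.
  elim: w' x => [|y w' IHw] x xL //= /andP[xy /IHw sub] z.
  by have yL := clL _ xL _ xy; rewrite inE => /orP[/eqP->|/(sub yL)].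
suff sub : {subset w <= L}.
  by rewrite cardE uniq_leq_size => [//||z /sub]; [case/andP: uw|rewrite mem_enum].
case/hasP: hL => x /splitPr wx xL; case: wx uw => w1 w2 uw.
have u2 : upath G (x :: w2).
  case/andP: uw => so un; apply/andP; split.
    by have := drop_sorted (size w1) so; rewrite drop_size_cat.
  by move: un; rewrite cat_uniq => /and3P[].
have u1 : upath G (x :: rev w1).
  rewrite -rev_rcons upath_rev; have := upath_take (size w1).+1 uw.
  by rewrite -cat_rcons take_size_cat ?size_rcons.
move=> z; rewrite mem_cat inE => /or3P[zw|/eqP->//|zw].
  by case/andP: u1 => /(clp _ _ xL) + _; apply; rewrite mem_rev.
by case/andP: u2 => /(clp _ _ xL) + _; apply.
Qed.

Section Construction.
Variables (F : finFieldType) (s n : nat).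
Notation p := s.*2.+1.
Notation Q := s.*2.+2.
Hypotheses (cardF : #|F| = p) (s_gt0 : 0 < s) (le_n : p * p <= n).
Local Open Scope ring_scope.

Lemma card_plane : (#|{: F * F}| <= n)%N.
Proof. by rewrite card_prod cardF. Qed.

Definition emb (u : F * F) : 'I_n := widen_ord card_plane (enum_rank u).

Lemma emb_inj : injective emb.
Proof. by move=> u v /(congr1 val)/= /val_inj/enum_rank_inj. Qed.

Definition coords (v : 'I_n) : option (F * F) := [pick u | emb u == v].

Lemma embK u : coords (emb u) = Some u.
Proof.
by rewrite /coords; case: pickP => [w /eqP/emb_inj->|/(_ u)]; rewrite ?eqxx.
Qed.

Lemma coordsK v u : coords v = Some u -> v = emb u.
Proof. by rewrite /coords; case: pickP => // w /eqP<- [->]. Qed.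

Lemma card_option_F : #|{: option F}| = Q.
Proof. by rewrite card_option cardF. Qed.

Definition code (o : option F) : 'I_Q := cast_ord card_option_F (enum_rank o).

Lemma code_inj : injective code.
Proof. by move=> a b /cast_ord_inj/enum_rank_inj. Qed.

Variable S : {set F}.
Hypotheses (S0 : 0 \notin S) (cardS : #|S| = s).

Definition slope (u v : F * F) : F := (u.2 - v.2) / (u.1 - v.1).

Lemma slopeC u v : slope u v = slope v u.
Proof. by rewrite /slope -(opprB v.2) -(opprB v.1) invrN mulrNN. Qed.

Lemma slopeE u v i : u.1 != v.1 -> (slope u v == i) = (u.2 - i * u.1 == v.2 - i * v.1).
Proof.
rewrite -subr_eq0 => neq; rewrite /slope -[i](mulfK neq) (inj_eq (mulIf _)) ?invr_eq0 //.
rewrite -subr_eq0 -[RHS]subr_eq0; congr (_ == 0).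
by rewrite !(mulfK neq) mulrBr; ring.
Qed.

(* [None] stands for the last color. The inner test removes from the line
   [y = i x] the pairs that contain no center, since that line is linked to
   the vertices outside the plane. *)
Definition direction (a b : option (F * F)) : option F :=
  match a, b with
  | Some u, Some v =>
    if u.1 == v.1 then None
    else if [&& u.2 == slope u v * u.1, v.2 == slope u v * v.1,
                u.1 \notin S & v.1 \notin S] then None
    else Some (slope u v)
  | Some u, None | None, Some u => if u.1 \in S then Some (u.2 / u.1) else None
  | None, None => None
  end.

Lemma directionC a b : direction a b = direction b a.
Proof.
case: a b => [u|] [v|] //=; rewrite (eq_sym v.1) (slopeC v u).
by case: (u.2 == _) (v.2 == _) (u.1 \in S) (v.1 \in S) => [] [] [] [].
Qed.

(** Edges are unordered, so [pick] chooses an ordering; [directionC] makes the color independent of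
    it. *)
Definition plane_coloring : {ffun {set 'I_n} -> 'I_Q} :=
  [ffun e : {set 'I_n} =>
    if [pick uv : 'I_n * 'I_n | e == [set uv.1; uv.2]] is Some uv
    then code (direction (coords uv.1) (coords uv.2)) else code None].

Notation c := plane_coloring.
Notation G o := (color_class c (code o)).

Lemma plane_coloringE u v : c [set u; v] = code (direction (coords u) (coords v)).
Proof.
rewrite ffunE; case: pickP => [[a b] /= /eqP e|/(_ (u, v))]; last by rewrite eqxx.
have ha : a \in [set u; v] by rewrite e set21.
have hb : b \in [set u; v] by rewrite e set22.
have hu : u \in [set a; b] by rewrite -e set21.
have hv : v \in [set a; b] by rewrite -e set22.
move: ha hb hu hv; rewrite !inE => /orP[]/eqP-> /orP[]/eqP-> //.
- by rewrite !orbb => _ /eqP->.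
- by rewrite directionC.
by rewrite !orbb => /eqP->.
Qed.

Lemma plane_adj o u v : adj (G o) u v = (u != v) && (direction (coords u) (coords v) == o).
Proof.
by rewrite /adj /= !inE cards2 eqSS eqb1 plane_coloringE (inj_eq code_inj).
Qed.

Definition line i b : {set 'I_n} := [set emb (x, i * x + b) | x in F].
Definition column x : {set 'I_n} := [set emb (x, y) | y in F].
Definition centers i : {set 'I_n} := [set emb (x, i * x) | x in S].

Lemma mem_column x y : emb (x, y) \in column x.
Proof. by apply/imsetP; exists y. Qed.

(** An edge from a point [(x, y)] to the outside of the plane has color [y / x] or the last color,
    so color [i] leaves the plane only from the line with [b = 0]. *)
Lemma line_closed i b : b != 0 ->
  {in line i b, forall u v, adj (G (Some i)) u v -> v \in line i b}.
Proof.
move=> b0 _ /imsetP[x _ ->] v; rewrite plane_adj embK => /andP[_].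
case cv: (coords v) => [[x' y']|] /=; last first.
  case: ifP => // xS; have x0 : x != 0 by apply: contraNneq S0 => <-.
  move=> /eqP[e]; have : i * x + b = i * x + 0 by rewrite addr0 -{2}e divfK.
  by move/addrI => bE; rewrite bE eqxx in b0.
case: ifP => [_ /eqP //|/negbT neq]; case: ifP => [_ /eqP //|_ /eqP[sE]].
move/eqP: sE; rewrite slopeE //= addrC addKr => /eqP bE; rewrite (coordsK cv).
by apply/imsetP; exists x'; rewrite ?inE // bE addrC subrK.
Qed.

(** The non-vertical pairs of the last color involve no abscissa in [S]. *)
Lemma column_closed x : x \in S ->
  {in column x, forall u v, adj (G None) u v -> v \in column x}.
Proof.
move=> xS _ /imsetP[y _ ->] v; rewrite plane_adj embK => /andP[_].
case cv: (coords v) => [[x' y']|] /=; last by rewrite xS.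
rewrite xS /= !andbF /=; case: ifP => [/eqP xx _|_ /eqP //].
by rewrite (coordsK cv) -xx mem_column.
Qed.

(** A path of color [i] is either trapped in a line of [p] points or confined to the line
    [y = i * x] and the outside of the plane, where the [s] centers cover all edges. *)
Lemma plane_pfree i : pfree p (G (Some i)).
Proof.
move=> w uw.
have [/existsP[b /andP[b0 hL]]|nL] := boolP [exists b, (b != 0) && has (mem (line i b)) w].
  apply: leq_trans (trapped_path (line_closed b0) uw hL) _.
  by rewrite -cardF leq_imset_card.
have leC : (#|centers i| <= s)%N by rewrite -cardS leq_imset_card.
apply: leq_trans (_ : (#|centers i|.*2.+1 <= p)%N); last by rewrite ltnS leq_double.
apply: path_vertex_cover uw => u v uw vw.
have onaxis z x y : z \in w -> coords z = Some (x, y) -> y = i * x.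
  move=> zw cz; apply/eqP; rewrite -subr_eq0; apply: contraR nL => b0.
  apply/existsP; exists (y - i * x); rewrite b0; apply/hasP; exists z => //=.
  by rewrite (coordsK cz); apply/imsetP; exists x; rewrite // addrC subrK.
rewrite plane_adj => /andP[_].
have inC z x y : z \in w -> coords z = Some (x, y) -> x \in S -> z \in centers i.
  move=> zw cz xS; rewrite (coordsK cz) (onaxis _ _ _ zw cz).
  by apply/imsetP; exists x.
case cu: (coords u) => [[x y]|]; case cv: (coords v) => [[x' y']|] //=.
- case: ifP => [_ /eqP //|/negbT neq]; case: ifP => [_ /eqP //|+ /eqP[sE]].
  rewrite sE (onaxis _ _ _ uw cu) (onaxis _ _ _ vw cv) !eqxx /=.
  move/negbT; rewrite negb_and !negbK => /orP[xS|xS].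
    by rewrite (inC _ _ _ uw cu xS).
  by rewrite (inC _ _ _ vw cv xS) orbT.
- by case: ifP => // xS _; rewrite (inC _ _ _ uw cu xS).
by case: ifP => // xS _; rewrite (inC _ _ _ vw cv xS) orbT.
Qed.

Lemma slope_edge_NIM u v i : u != v ->
  direction (coords u) (coords v) = Some i -> [set u; v] \in NIM_edges (path_graph Q) c.
Proof.
move=> neq dE; rewrite !inE cards2 neq /=; apply/negP => /existsP[j /existsP[f /andP[cf ef]]].
have : [set u; v] \in color_class c j.
  case/andP: cf => _ /forall_inP cf; case/imsetP: ef => d dP ->; exact: cf.
rewrite inE plane_coloringE dE => /andP[_ /eqP jE]; move: cf; rewrite -jE.
move=> /copy_upath/plane_pfree.
by rewrite size_map size_enum_ord ltnn.
Qed.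

Lemma column_edge_NIM x u v : x \in S -> u \in column x -> v \in column x ->
  u != v -> [set u; v] \in NIM_edges (path_graph Q) c.
Proof.
move=> xS uC vC neq; rewrite !inE cards2 neq /=.
apply/negP => /existsP[j /copy_edgesP[s1 [a [b [s2 [us sz abE]]]]]].
have ab : adj (color_class c j) a b.
  case/andP: us => /(drop_sorted (size s1)); rewrite drop_size_cat // => so _.
  by case/andP: so.
have jE : j = code None.
  move: ab; rewrite /adj /= -abE inE => /andP[_ /eqP <-].
  case/imsetP: uC => y _ ->; case/imsetP: vC => y' _ ->.
  by rewrite plane_coloringE !embK /= eqxx.
rewrite {j}jE in us ab.
have aC : a \in column x.
  by have := set21 a b; rewrite -abE !inE => /orP[]/eqP->.
have hC : has (mem (column x)) (s1 ++ [:: a, b & s2]).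
  by rewrite has_cat /= aC orbT.
have := trapped_path (column_closed xS) us hC; rewrite sz.
rewrite leqNgt ltnS (leq_trans (leq_imset_card _ _)) ?cardF //.
Qed.

Definition special : {set 'I_n} := [set emb u | u in setX S setT].

Lemma card_special : #|special| = (s * p)%N.
Proof.
by rewrite card_imset; [rewrite cardsX cardS cardsT cardF|apply: emb_inj].
Qed.

Lemma special_edge_NIM u v : u != v -> u \in special ->
  [set u; v] \in NIM_edges (path_graph Q) c.
Proof.
move=> neq /imsetP[[x y] /setXP[/= xS _] uE].
case cv: (coords v) => [[x' y']|].
  have [xx|nxx] := eqVneq x x'.
    by apply: (column_edge_NIM xS) => //; rewrite ?uE ?(coordsK cv) -?xx mem_column.
  apply: (slope_edge_NIM neq (i := slope (x, y) (x', y'))).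
  by rewrite uE embK cv /= (negPf nxx) xS /= !andbF.
by apply: (slope_edge_NIM neq (i := y / x)); rewrite uE embK cv /= xS.
Qed.

Lemma special_NIM : touching special \subset NIM_edges (path_graph Q) c.
Proof.
apply/subsetP => e; rewrite inE => /andP[]; rewrite inE.
case/cards2P=> u [v [neq ->]] /set0Pn[z] /setIP[/set2P[]-> zS].
  exact: special_edge_NIM.
by rewrite setUC; apply: special_edge_NIM; rewrite 1?eq_sym.
Qed.

Definition chord (t : {set F} * (F * F)) : {set 'I_n} :=
  [set emb (x, t.2.1 * x + t.2.2) | x in t.1].

(** Codes of NIM-edges that avoid [special]: two abscissas outside [S] and a line that misses the
    origin, in product form for counting. *)
Definition chords : {set {set F} * (F * F)} :=
  setX [set D : {set F} | D \subset ~: S & #|D| == 2] (setX setT [set~ 0]).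

(** The abscissas recover [D], and the values at two distinct abscissas determine the line. *)
Lemma chord_inj : {in chords &, injective chord}.
Proof.
move=> [D [i b]] [D' [i' b']] /setXP[/= + _] /setXP[/= + _] e.
rewrite !inE => /andP[_ /eqP cD] /andP[_ /eqP cD'].
have sub x : x \in D -> x \in D' /\ i * x + b = i' * x + b'.
  move=> xD; have : emb (x, i * x + b) \in chord (D, (i, b)) by apply: imset_f.
  by rewrite e => /imsetP[x' x'D' /emb_inj[-> ->]].
have DE : D = D'.
  by apply/eqP; rewrite eqEcard cD cD' leqnn andbT; apply/subsetP => x /sub[].
case/eqP/cards2P: (cD) => x [y [neq DD]].
have [|_ ex] := sub x; first by rewrite DD set21.
have [|_ ey] := sub y; first by rewrite DD set22.
have iE : i = i'.
  apply/eqP; rewrite -subr_eq0; have : (i - i') * (x - y) == 0.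
    have -> : (i - i') * (x - y) =
      (i * x + b) - (i * y + b) - ((i' * x + b') - (i' * y + b')) by ring.
    by rewrite ex ey subrr.
  by rewrite mulf_eq0 [x - y == 0]subr_eq0 (negPf neq) orbF.
by move: ex; rewrite -DE iE => /addrI->.
Qed.

Lemma card_chords : #|chords| = ('C(s.+1, 2) * (p * p.-1))%N.
Proof.
rewrite !cardsX cards_draws cardsT cardF cardsC1 cardF.
by congr ('C(_, 2) * _)%N; have := cardsC S; rewrite cardS cardF; lia.
Qed.

Lemma chord_NIM t : t \in chords -> chord t \in NIM_edges (path_graph Q) c :\: touching special.
Proof.
case: t => [D [i b]] /setXP[/= /setIdP[sD cD] /setXP[_ /=]]; rewrite in_setC1 => b0.
have SD x : x \in D -> x \notin S by move/(subsetP sD); rewrite inE.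
rewrite in_setD; apply/andP; split.
  rewrite inE negb_and; apply/orP; right; rewrite negbK; apply/eqP/setP => z.
  rewrite !inE; apply/negP => /andP[/imsetP[x xD ->] /imsetP[[x' y'] /setXP[/= x'S _]]].
  by case/emb_inj=> xx _; have := SD x xD; rewrite xx x'S.
case/cards2P: cD => x [y [neq DE]].
have -> : chord (D, (i, b)) = [set emb (x, i * x + b); emb (y, i * y + b)].
  by rewrite /chord /= DE imsetU1 imset_set1.
have := @slope_edge_NIM (emb (x, i * x + b)) (emb (y, i * y + b)) i.
apply; first by rewrite (inj_eq emb_inj) xpair_eqE (negPf neq).
have sE : slope (x, i * x + b) (y, i * y + b) = i.
  by apply/eqP; rewrite slopeE //= !(addrC (i * _)) !addrK.
rewrite !embK /= (negPf neq) sE; case: ifP => // /and4P[+ _ _ _].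
by rewrite -subr_eq0 addrC addKr (negPf b0).
Qed.

Lemma plane_coloring_bound :
  ('C(n, 2) - 'C(n - s * p, 2) + 'C(s.+1, 2) * (p * p.-1) <=
   #|NIM_edges (path_graph Q) c|)%N.
Proof.
rewrite -(cardsID (touching special)) (setIidPr special_NIM) leq_add //.
  by have := card_touching special; rewrite card_ord card_special => <-; rewrite addnK.
rewrite -card_chords -(card_in_imset chord_inj).
by apply/subset_leq_card/subsetP => _ /imsetP[t tC ->]; apply: chord_NIM.
Qed.

End Construction.

(** * The bounds on [nim] and their comparison *)

Lemma nim_le s n : 0 < s -> s.*2.+2 ^ (2 * s.+1 ^ 2) <= n ->
  nim s.*2.+2 n (path_graph s.*2.+2) <=
  s.*2.+1 * turan_number n (path_graph s.*2.+2) + s * (s * s.*2.+1).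
Proof.
move=> s0 hn; have lesn : s <= n.
  apply: leq_trans hn; apply: leq_trans (ltnW (ltn_expl s (_ : 1 < s.*2.+2))) _ => //.
  by rewrite leq_pexp2l //; nia.
apply/bigmax_leqP => c _; apply: nim_upper_bound; rewrite ?card_ord //.
  move=> i; apply: leq_turan_number; last exact: nim_color_pfree.
  exact: subset_trans (nim_color_sub c i) (color_class_simple c i).
exact: turan_number_ge.
Qed.

(** The case [k = 1]: each edge is by itself a monochromatic copy. *)
Lemma nim_edge_graph n : nim 2 n (path_graph 2) = 0.
Proof.
apply/eqP; rewrite -leqn0; apply/bigmax_leqP => c _; rewrite leqn0 cards_eq0.
apply/eqP/setP => e; rewrite [RHS]inE; apply/negP => eN.
have : e \in complete_graph 'I_n by move: eN; rewrite inE => /andP[].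
rewrite inE => /cards2P[u [v [neq eE]]]; rewrite eE in eN.
apply: (negP (@nim_not_on_path _ 0 c (c e) [::] u v [::] _ _) eN) => //.
rewrite upath_cons; apply/and3P; split=> //; last by rewrite inE.
by apply: (@color_adj _ 0 c); rewrite // -eE.
Qed.

Lemma nim_ge s n : 0 < s -> prime s.*2.+1 -> s.*2.+1 * s.*2.+1 <= n ->
  'C(n, 2) - 'C(n - s * s.*2.+1, 2) + 'C(s.+1, 2) * (s.*2.+1 * s.*2)
  <= nim s.*2.+2 n (path_graph s.*2.+2).
Proof.
move=> s0 pr le_n; have cF := card_Fp pr.
have [|S [/subsetP S0 cS]] := @exists_subset_card 'F_(s.*2.+1) [set~ 0%R] s.
  by rewrite cardsC1 cF /=; lia.
have {}S0 : 0%R \notin S by apply/negP => /S0; rewrite !inE eqxx.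
apply: leq_trans (plane_coloring_bound cF s0 le_n S0 cS) _.
exact: (leq_bigmax (F := fun c => #|NIM_edges (path_graph s.*2.+2) c|)).
Qed.

Lemma fs_extremal_count s n : 0 < s -> s.*2.+1 * s.*2.+1 <= n ->
  n %% s.*2.+1 = s \/ n %% s.*2.+1 = s.+1 ->
  s.*2.+1 * fs s n + s * (s * s.*2.+1) <=
  'C(n, 2) - 'C(n - s * s.*2.+1, 2) + 'C(s.+1, 2) * (s.*2.+1 * s.*2).
Proof.
move=> s0 le_n hr.
have Efs : 2 * fs s n + s * s.+1 = 2 * (s * n).
  rewrite -(fs_double s n); congr (_ + _).
  case: hr => ->; last rewrite mulnC; congr (_ * _); lia.
have le_m : s * s.*2.+1 < n by nia.
have := bin2_double n; have := bin2_double (n - s * s.*2.+1).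
have := bin2_double s.+1; have := leq_bin2l 2 (leq_subr (s * s.*2.+1) n).
move: 'C(n, 2) 'C(n - _, 2) 'C(s.+1, 2) => x y z /= leyx Ez Ey Ex.
(* The number of vertices over [S]. Once doubled, both sides become multiples of [m], the term
   [d.+1 * d] cancelling between [x] and [y]. *)
set m := s * s.*2.+1 in le_m Ey leyx *.
have [d dE] : exists d, n = m + d.+1 by exists (n - m).-1; lia.
have mE : m = 2 * (s * s) + s by rewrite /m mulnS -mul2n; lia.
have {}Ex : x * 2 = m * (m + d + d.+1) + d.+1 * d.
  by rewrite Ex dE addnS /=; rewrite -!addnS; clear; lia.
have {}Ey : y * 2 = d.+1 * d by rewrite Ey dE addKn.
have {}Ez : z * (s.*2.+1 * s.*2) * 2 = m * (2 * (s.+1 * s)).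
  rewrite mulnAC Ez /m -mul2n; clear; move: (2 * s).+1 => q; lia.
have {Efs} Ef : s.*2.+1 * fs s n * 2 + m * s.+1 = m * (2 * (m + d.+1)).
  have := congr1 (muln s.*2.+1) Efs; rewrite -dE /m; clear.
  move: s.*2.+1 (fs s n) => q f; lia.
have Esum : m * (2 * (m + d.+1)) + s * m * 2 =
    m * (m + d + d.+1) + m * (2 * (s.+1 * s)) + m * s.+1.
  rewrite [s * m]mulnC -[m * s * 2]mulnA -!mulnDr; congr (m * _).
  by rewrite mE; clear; lia.
move: Ex Ey Ez Ef Esum leyx; clear.
by move: (m * (2 * (m + d.+1))) (m * (m + d + d.+1)) (d.+1 * d)
  (z * (s.*2.+1 * s.*2)) (m * (2 * _)) (m * s.+1) (s * m) (s.*2.+1 * fs s n) => *; lia.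
Qed.

Theorem theorem1p5 (k n : nat) (hk : 1 <= k)
    (hn : (2 * k) ^ (2 * k ^ 2) <= n) :
  nim (2 * k) n (path_graph (2 * k))
    <= (2 * k - 1) * turan_number n (path_graph (2 * k))
       + (k - 1) * 'C(2 * k - 1, 2)
  /\
  (prime (2 * k - 1) ->
   (exists a : nat,
      n = a * (2 * k - 1) + (k - 1) \/ n = a * (2 * k - 1) + k) ->
   nim (2 * k) n (path_graph (2 * k))
     = (2 * k - 1) * turan_number n (path_graph (2 * k))
       + (k - 1) * 'C(2 * k - 1, 2)).
Proof.
case: k hk hn => // s _; have -> : 2 * s.+1 = s.*2.+2 by lia.
rewrite !subn1 /= => hn.
have -> : 'C(s.*2.+1, 2) = s * s.*2.+1 by have := bin2_double s.*2.+1; nia.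
have [s_eq0|s0] := posnP s.
  by subst s; rewrite nim_edge_graph.
have le := nim_le s0 hn; split=> // pr [a ha].
have le_n : s.*2.+1 * s.*2.+1 <= n.
  apply: leq_trans hn; apply: (@leq_trans (s.*2.+2 ^ 2)).
    by rewrite expnS expn1 leq_mul.
  by rewrite leq_pexp2l //; nia.
have hr : n %% s.*2.+1 = s \/ n %% s.*2.+1 = s.+1.
  by case: ha => ->; rewrite modnMDl modn_small; [left| |right|]; lia.
apply/eqP; rewrite eqn_leq le /=.
apply: leq_trans (nim_ge s0 pr le_n); apply: leq_trans (fs_extremal_count s0 le_n hr).
by rewrite leq_add2r leq_mul2l turan_number_le // orbT.
Qed.
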